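(* Let $n\ge 4$. Any canal space-like hypersurface of elliptic type in the Minkowski space $\mathbb{R}^{n+1}_1$ is a Riemannian manifold of quasi-constant sectional curvatures with functions $a<0$ and $a+k^2>0$.
   Context: QC-manifolds. $(M,g,\xi)$ denotes an $n$-dimensional Riemannian manifold with metric $g$ and a unit vector field $\xi$; $\eta(X)=g(\xi,X)$, and $\Delta(p)=\{X\in T_pM:\eta(X)=0\}$. $(M,g,\xi)$ is a Riemannian manifold of quasi-constant sectional curvatures (Riemannian QC-manifold) if for every $p\in M$ and every 2-plane $E\subset T_pM$ the sectional curvature of $E$ depends only on $p$ and on the angle between $E$ and $\xi$. Equivalently, the curvature tensor has the form $\mathcal R=a\,\pi+b\,\Phi$ for some functions $a,b$ on $M$, where $\pi(X,Y,Z,U)=g(Y,Z)g(X,U)-g(X,Z)g(Y,U)$ and $\Phi(X,Y,Z,U)=g(Y,Z)\eta(X)\eta(U)-g(X,Z)\eta(Y)\eta(U)+g(X,U)\eta(Y)\eta(Z)-g(Y,U)\eta(X)\eta(Z)$ (sign convention: $\mathcal R=c\,\pi$ means constant sectional curvature $c$). The function $k$ is defined by $\nabla_x\xi=k\,x$ for $x\in\Delta$ (when $b\ne0$, $k=\xi(a)/(2b)$), where $\nabla$ is the Levi-Civita connection of $g$. Canal space-like hypersurfaces. $\mathbb{R}^{n+1}_1$ is Minkowski space with scalar product of signature $(n,1)$; products of vectors are scalar products. A hypersurface $M$ of dimension $n$ is space-like if the induced metric is positive definite. A space-like hypersphere with center $z$ and radius $R>0$ is $\{Z:(Z-z)^2=-R^2\}$.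 A sphere of codimension two is an $(n-1)$-dimensional cross-section $S^{n-1}$ of a space-like hypersphere with a hyperplane. A canal space-like hypersurface is a space-like hypersurface $M=\{S^{n-1}(s)\}$, $s\in J\subset\mathbb R$, which is a one-parameter family of spheres of codimension two (spherical generators) such that the normals to $M$ at the points of any fixed generator $S^{n-1}(s)$ pass through a fixed point $z(s)$. Its position vector $Z$ then satisfies $(Z-z(s))^2=-R^2(s)$ and $(Z-z(s))\,z'(s)=R(s)R'(s)$, with $R(s)>0$. Such an $M$ is endowed with the induced metric $g$ and the unit tangent vector field $\xi=\frac{t-R'N}{\sqrt{(t-R'N)^2}}$, where $t=z'$ and $N=-\frac{Z-z}{R}$ is the unit normal ($N^2=-1$). It is of elliptic type if the curve of centers $z(s)$ is time-like. *)

(* Defs.v *)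
From HB Require Import structures.
From mathcomp Require Import all_boot all_order all_algebra.
From mathcomp Require Import all_classical all_reals all_analysis.
Set Implicit Arguments.
Unset Strict Implicit.
Unset Printing Implicit Defensive.
Import Order.TTheory GRing.Theory Num.Theory.
Import numFieldNormedType.Exports.
Local Open Scope classical_set_scope.
Local Open Scope ring_scope.

Fixpoint Ck (R : realType) (V W : normedModType R) (k : nat) (U : set V)
    (f : V -> W) : Prop :=
  match k with
  | 0 => forall u, U u -> {for u, continuous f}
  | k'.+1 => (forall u, U u -> differentiable f u) /\
             forall v, Ck k' U ('D_v f)
  end.

Definition smooth (R : realType) (V W : normedModType R) (U : set V)
    (f : V -> W) : Prop :=
  forall k, Ck k U f.

(* A metric in a coordinate chart is given by its Gram matrices [g u] with respect
   to the coordinate frame at the point of coordinates [u]; a tangent vector at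
   that point is the row of its components. *)

Section Chart.
Variables (R : realType) (n : nat) (g : 'rV[R]_n -> 'M[R]_n).
Implicit Types (u x y z w : 'rV[R]_n) (xi : 'rV[R]_n -> 'rV[R]_n).

Definition partial (i : 'I_n) (f : 'rV[R]_n -> R) : 'rV[R]_n -> R :=
  'D_(delta_mx 0 i) (f : _ -> R^o).

Definition inner u x y : R := (x *m g u *m y^T) 0 0.

(* [christoffel k i j u] is Gamma^k_ij: the connection is the Levi-Civita one. *)
Definition christoffel (k i j : 'I_n) u : R :=
  2^-1 * \sum_l invmx (g u) k l *
    (partial i (fun v => g v j l) u + partial j (fun v => g v i l) u
     - partial l (fun v => g v i j) u).

Definition nabla u x xi : 'rV[R]_n :=
  \row_k \sum_i x 0 i *
    (partial i (fun v => xi v 0 k) u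
     + \sum_j christoffel k i j u * xi u 0 j).

(* R(d_i, d_j) d_k = \sum_l (curv i j k l) d_l, where
   R(X, Y) Z = nabla_X nabla_Y Z - nabla_Y nabla_X Z - nabla_[X, Y] Z. *)
Definition curv (i j k l : 'I_n) u : R :=
  partial i (christoffel l j k) u - partial j (christoffel l i k) u
  + \sum_m (christoffel m j k u * christoffel l i m u
            - christoffel m i k u * christoffel l j m u).

(* R(x, y, z, w) = g(R(x, y) z, w): constant curvature c means [c * pi_form]. *)
Definition riemann u x y z w : R :=
  \sum_i \sum_j \sum_k \sum_l \sum_m
    x 0 i * y 0 j * z 0 k * w 0 m * curv i j k l u * g u l m.

Definition pi_form u x y z w : R :=
  inner u y z * inner u x w - inner u x z * inner u y w.

Definition phi_form xi u x y z w : R :=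
  let eta := inner u (xi u) in
  inner u y z * eta x * eta w - inner u x z * eta y * eta w
  + inner u x w * eta y * eta z - inner u y w * eta x * eta z.

(* 2-planes are represented by their orthonormal bases. *)
Definition orthonormal u x y : Prop :=
  [/\ inner u x x = 1, inner u y y = 1 & inner u x y = 0].

Definition sectional u x y : R := riemann u x y y x.

(* The angle between a unit vector and a plane is the one between the vector and
   its orthogonal projection on the plane, whose length is its cosine. *)
Definition plane_angle xi u x y : R :=
  acos (Num.sqrt (inner u (xi u) x ^+ 2 + inner u (xi u) y ^+ 2)).

Definition quasi_constant_at xi u : Prop :=
  forall x y x' y',
    orthonormal u x y -> orthonormal u x' y' ->
    plane_angle xi u x y = plane_angle xi u x' y' ->
    sectional u x y = sectional u x' y'.

End Chart.

(* A smooth immersion which is a homeomorphism of [U] onto a relatively open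
   subset of [M]. *)
Record local_param (R : realType) (m N : nat) (M : set 'rV[R]_N)
    (U : set 'rV[R]_m) (X : 'rV[R]_m -> 'rV[R]_N) : Prop := LocalParam {
  lp_open : open U;
  lp_smooth : smooth U X;
  lp_immersion : forall u, U u -> row_free ('J X u);
  lp_inj : set_inj U X;
  lp_openmap : forall W, open W -> W `<=` U ->
    exists V, open V /\ X @` W = M `&` V }.

Definition submanifold (R : realType) (m N : nat) (M : set 'rV[R]_N) : Prop :=
  forall p, M p -> exists (U : set 'rV[R]_m) (X : 'rV[R]_m -> 'rV[R]_N),
    local_param M U X /\ (X @` U) p.

Section Minkowski.
Variables (R : realType) (n : nat).
Notation E := 'rV[R]_n.+1.
Implicit Types (M : set E) (xi : E -> E) (p : E).

(* Signature (n, 1), the last coordinate being the negative one. *)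
Definition mdot (x y : E) : R :=
  \sum_(i < n) x 0 (lift ord_max i) * y 0 (lift ord_max i)
  - x 0 ord_max * y 0 ord_max.

(* First fundamental form of a parametrization [X]; the tangent vector of
   components [x] is [x *m 'J X u]. *)
Definition induced (X : 'rV[R]_n -> E) (u : 'rV[R]_n) : 'M[R]_n :=
  \matrix_(i, j) mdot (row i ('J X u)) (row j ('J X u)).

(* Components of an ambient vector field tangent to the hypersurface. *)
Definition components (X : 'rV[R]_n -> E) xi (u : 'rV[R]_n) : 'rV[R]_n :=
  xi (X u) *m pinvmx ('J X u).

Definition spacelike_hypersurface M : Prop :=
  submanifold n M /\
  forall (U : set 'rV[R]_n) X, local_param M U X -> forall u, U u ->
    forall x, x != 0 -> 0 < inner (induced X) u x x.

Definition unit_tangent_field M xi : Prop :=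
  forall (U : set 'rV[R]_n) X, local_param M U X ->
    smooth U (xi \o X) /\
    forall u, U u ->
      (xi (X u) <= 'J X u)%MS /\ mdot (xi (X u)) (xi (X u)) = 1.

(* (M, g, xi) with g the metric induced on M. *)
Definition QC_manifold M xi : Prop :=
  [/\ spacelike_hypersurface M, unit_tangent_field M xi &
      forall (U : set 'rV[R]_n) X, local_param M U X -> forall u, U u ->
        quasi_constant_at (induced X) (components X xi) u].

(* R = a pi + b Phi *)
Definition QC_curvature M xi (a b : E -> R) : Prop :=
  forall (U : set 'rV[R]_n) X, local_param M U X -> forall u, U u ->
    forall x y z w,
      riemann (induced X) u x y z w =
        a (X u) * pi_form (induced X) u x y z w
        + b (X u) * phi_form (induced X) (components X xi) u x y z w.

(* nabla_x xi = k x for every x orthogonal to xi *)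
Definition QC_k M xi (k : E -> R) : Prop :=
  forall (U : set 'rV[R]_n) X, local_param M U X -> forall u, U u ->
    forall x, inner (induced X) u (components X xi u) x = 0 ->
      nabla (induced X) u x (components X xi) = k (X u) *: x.

Definition spacelike_hypersphere (c : E) (r : R) : set E :=
  [set Z | mdot (Z - c) (Z - c) = - r ^+ 2].

Definition hyperplane (v : E) (d : R) : set E := [set Z | mdot v Z = d].

Definition sphere_codim2 (S : set E) : Prop :=
  exists c r v d, [/\ 0 < r, v != 0,
    S = spacelike_hypersphere c r `&` hyperplane v d,
    S !=set0 & submanifold n.-1 S].

Definition normal_through M p (c : E) : Prop :=
  forall (U : set 'rV[R]_n) X, local_param M U X -> forall u, U u ->
    X u = p -> forall x, mdot (p - c) (x *m 'J X u) = 0.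

(* [S s] is the generator of parameter [s], [sigma p] the parameter of the
   generator through [p], [z s] the point common to the normals along [S s] and
   [rad] the function R(s) such that (Z - z(s))^2 = - R(s)^2. *)
Record canal_spacelike_hypersurface M (J : set R) (S : R -> set E)
    (sigma : E -> R) (z : R -> E) (rad : R -> R) : Prop := Canal {
  canal_spacelike : spacelike_hypersurface M;
  canal_open : open J;
  canal_interval : is_interval J;
  canal_sphere : forall s, J s -> sphere_codim2 (S s);
  canal_cover : M = \bigcup_(s in J) S s;
  canal_param : forall p, M p -> forall s, J s -> (S s p <-> sigma p = s);
  canal_param_smooth : forall (U : set 'rV[R]_n) X, local_param M U X ->
    smooth U (sigma \o X : _ -> R^o);
  canal_center_smooth : smooth (J : set R^o) (z : R^o -> _);
  canal_radius_smooth : smooth (J : set R^o) (rad : R^o -> R^o);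
  canal_radius_gt0 : forall s, J s -> 0 < rad s;
  canal_normals : forall s, J s -> forall p, S s p ->
    normal_through M p (z s);
  canal_radius : forall s, J s -> forall p, S s p ->
    mdot (p - z s) (p - z s) = - rad s ^+ 2 }.

Definition elliptic_type (J : set R) (z : R -> E) : Prop :=
  forall s, J s -> mdot (derive1 z s) (derive1 z s) < 0.

Definition canal_normal (sigma : E -> R) (z : R -> E) (rad : R -> R) p : E :=
  - ((rad (sigma p))^-1 *: (p - z (sigma p))).

Definition canal_xi (sigma : E -> R) (z : R -> E) (rad : R -> R) p : E :=
  let v := derive1 z (sigma p)
           - derive1 rad (sigma p) *: canal_normal sigma z rad p in
  (Num.sqrt (mdot v v))^-1 *: v.

End Minkowski.

(* Main.v *)
Require Import Defs.
From HB Require Import structures.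
From mathcomp Require Import all_boot all_order all_algebra.
From mathcomp Require Import all_classical all_reals all_analysis.
From mathcomp Require Import ring lra.
Import Defs.
Import Order.TTheory GRing.Theory Num.Theory.
Import numFieldNormedType.Exports.
Local Open Scope classical_set_scope.
Local Open Scope ring_scope.
Set Implicit Arguments.
Unset Strict Implicit.
Unset Printing Implicit Defensive.

(** Let X be a chart of M, with coordinate fields X_i, and put s = sigma o X,
    R = rad s, t = z'(s), N = - (X - z(s)) / R.  That the normals along a
    generator pass through z(s) says (X - z(s)).X_i = 0, so N is a unit normal
    with N.N = -1.  Differentiating (X - z(s))^2 = - R^2 gives
    (d_i s) ((X - z(s)).t - R R') = 0.  The second factor vanishes everywhere:
    otherwise s would be constant on a ball, the ball would be mapped into the
    intersection of a hyperplane v.Z = d with a quadric, N would be proportional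
    to v, and X would be constant there ([canal_center_eq]).

    Hence w = t - R' N is tangent and w.w = t.t + R'^2 depends on s only.  It is
    positive: if it vanished at one point, then t = R' N along the whole
    generator, with R' != 0 because t is time-like, so N and therefore X would be
    constant on a generator, which has at least two points
    ([canal_sqnorm_gt0]).  Differentiating (X - z(s)).t = R R' gives
    w.X_i = A d_i s for a function A, and A != 0 because w != 0.
    Differentiating (X - z(s)).X_j = 0 gives the second fundamental form
      X_ij.N = (g_ij - A (d_i s)(d_j s)) / R
             = (g_ij - (w.w / A) eta_i eta_j) / R.
    With N time-like, the Gauss equation ([riemann_gauss]) gives
    the curvature tensor a pi + b Phi with a = - 1 / R^2 and b = w.w / (A R^2)
    ([canal_curvature]).

    Along M the field xi = w / |w| has the form P(s) + q(s) X with
    q = R' / (R |w|).  If x is orthogonal to xi, then ds(x) = 0, so the derivative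
    of xi along x is q x, whence k = q ([canal_nabla]).  Finally
    a + k^2 = - t.t / (R^2 w.w), which is positive because t is time-like.

    A sectional curvature equals a + b (eta(x)^2 + eta(y)^2) for an orthonormal
    basis (x, y) of the plane, and the bracket is the squared cosine of the angle
    between xi and the plane ([canal_quasi_constant]).

    The analytic input is the calculus of smooth maps between normed spaces and
    the symmetry of second derivatives ([derive_comm]); the latter makes
    the connection torsion-free and the third derivatives of X drop out of the
    Gauss equation. *)

(** * Differentiation rules *)

Section Pointwise.
Variables (R : realType) (V W : normedModType R).

(** The difference g - f vanishes near x, so 0 is a differential for it. *)
Lemma near_eq_differentiable (f g : V -> W) x :
  {near x, f =1 g} -> differentiable f x -> differentiable g x.
Proof.
move=> fg df; have -> : g = f + (g - f) by apply/funext => y /=; rewrite addrC subrK.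
apply: differentiableD => //.
have h0 : \forall y \near 0, (g - f) (y + x) = 0.
  have cx : (fun y : V => y + x) @ 0 --> x.
    by rewrite -[X in _ --> X]add0r; apply: cvgD; [exact: cvg_id|exact: cvg_cst].
  have fg0 : \forall y \near 0, f (y + x) = g (y + x) by exact: (cx _ fg).
  near=> y; have e : f (y + x) = g (y + x) by near: y; exact: fg0.
  by apply/eqP; rewrite [_ == _]subr_eq0 e.
have h1 : (g - f) \o shift x = cst ((g - f) x) + \0 +o_ (0 : V) id.
  apply/eqaddoP => e e0; near=> y.
  have -> : ((g - f) \o shift x - (cst ((g - f) x) + \0)) y =
            (g - f) (y + x) - ((g - f) x + 0) by [].
  have -> : (g - f) (y + x) = 0 by near: y.
  have -> : (g - f) x = 0 by have /nbhs_singleton := h0; rewrite add0r.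
  by rewrite addr0 subr0 normr0 mulr_ge0// ltW.
have c0 : continuous (\0 : {linear V -> W}) by exact: cst_continuous.
by apply/diff_locallyP; rewrite (diff_unique c0 h1).
Unshelve. all: by end_near. Qed.

Lemma scaler_is_bilinear :
  bilinear_for
    (GRing.Scale.Law.clone _ _ *:%R _) (GRing.Scale.Law.clone _ _ *:%R _)
    (@GRing.scale R W : R^o -> W -> W).
Proof.
split=> [u'|u] a x y /=.
- by rewrite scalerDl scalerA.
- by rewrite scalerDr !scalerA mulrC.
Qed.

HB.instance Definition _ := bilinear_isBilinear.Build R
  R^o W W _ _ (@GRing.scale R W : R^o -> W -> W) scaler_is_bilinear.

(** The product rule: scaling is a continuous bilinear map, composed here with
    the pair (a, f). *)
Lemma is_diff_scale (a : V -> R^o) (f : V -> W) x :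
  differentiable a x -> differentiable f x ->
  is_diff x (fun y => a y *: f y) (fun v => 'd a x v *: f x + a x *: 'd f x v).
Proof.
move=> da df.
pose B : R^o * W -> W := fun p => p.1 *: p.2.
have -> : (fun y => a y *: f y) = B \o (fun y => (a y, f y)) by [].
have cB : continuous B by move=> p; exact: scale_continuous.
have dB p : differentiable B p.
  by exact: (@differentiable_bilin _ _ _ _ (@GRing.scale R W : R^o -> W -> W)).
have dp := differentiable_pair da df.
apply: DiffDef; first exact: differentiable_comp.
rewrite diff_comp// (@diff_bilin _ _ _ _ (@GRing.scale R W : R^o -> W -> W)) //.
by rewrite diff_pair//; apply/funext => v /=; rewrite addrC.
Qed.

Lemma differentiable_scale (a : V -> R^o) (f : V -> W) x :
  differentiable a x -> differentiable f x ->
  differentiable (fun y => a y *: f y) x.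
Proof. by move=> da df; have [] := is_diff_scale da df. Qed.

Lemma derive_scale (a : V -> R^o) (f : V -> W) x v :
  differentiable a x -> differentiable f x ->
  'D_v (fun y => a y *: f y) x = 'D_v a x *: f x + a x *: 'D_v f x.
Proof.
move=> da df; have [dF eF] := is_diff_scale da df.
by rewrite !deriveE// eF.
Qed.

Lemma derive_curve (g : R^o -> W) (s : V -> R^o) x v :
  differentiable s x -> differentiable g (s x) ->
  'D_v (g \o s) x = 'D_v s x *: 'D_1 g (s x).
Proof.
move=> ds dg; rewrite !deriveE//; last exact: differentiable_comp.
rewrite diff_comp//= -[X in 'd g _ X](mulr1 ('d s x v)).
by rewrite -[X in 'd g _ X]/('d s x v *: (1 : R^o)) linearZ.
Qed.
End Pointwise.

Lemma near_eq_derive_open (R : realType) (V W : normedModType R) (U : set V)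
    (f g : V -> W) u v : open U -> U u -> (forall x, U x -> f x = g x) ->
  'D_v f u = 'D_v g u.
Proof.
move=> oU Uu fg; apply: near_eq_derive; near=> x; apply: fg; near: x.
exact: open_nbhs_nbhs.
Unshelve. all: by end_near. Qed.

Lemma derive_lin (R : realType) (V W W' : normedModType R) (L : {linear W -> W'})
  (f : V -> W) x v : continuous L -> differentiable f x ->
  'D_v (L \o f) x = L ('D_v f x).
Proof.
move=> cL df; have dL y : differentiable L y by exact: linear_differentiable.
rewrite !deriveE//; last exact: differentiable_comp.
by rewrite diff_comp//= diff_lin.
Qed.

Lemma differentiable_coordinate (R : realType) (V : normedModType R) m
    (f : V -> 'rV[R]_m) u i :
  differentiable f u -> differentiable (fun v => f v 0 i : R^o) u.
Proof.
move=> df.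
apply: (differentiable_comp (g := fun N : 'rV[R]_m => N 0 i : R^o) df).
exact: differentiable_coord.
Qed.

Lemma derive_coord (R : realType) (V : normedModType R) m
    (f : V -> 'rV[R]_m) u v i : differentiable f u ->
  'D_v (fun w => f w 0 i : R^o) u = 'D_v f u 0 i.
Proof.
by move=> df; rewrite derive_mx ?mxE //; exact: diff_derivable.
Qed.

Lemma differentiable_bigsum (R : realType) (V W : normedModType R) (I : Type)
    (r : seq I) (P : pred I) (F : I -> V -> W) u :
  (forall i, P i -> differentiable (F i) u) ->
  differentiable (fun v => \sum_(i <- r | P i) F i v) u.
Proof.
move=> dF; elim: r => [|i r IH].
  rewrite (_ : (fun _ => _) = cst 0); first exact: differentiable_cst.
  by apply/funext => v; rewrite big_nil.
case: (boolP (P i)) => [Pi|nPi].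
  rewrite (_ : (fun _ => _) = F i + (fun v => \sum_(i <- r | P i) F i v)).
    by apply: differentiableD => //; exact: dF.
  by apply/funext => v; rewrite big_cons Pi.
rewrite (_ : (fun _ => _) = (fun v => \sum_(i <- r | P i) F i v)) //.
by apply/funext => v; rewrite big_cons (negbTE nPi).
Qed.

Lemma derive_bigsum (R : realType) (V W : normedModType R) (I : Type)
    (r : seq I) (P : pred I) (F : I -> V -> W) u w :
  (forall i, P i -> differentiable (F i) u) ->
  'D_w (fun v => \sum_(i <- r | P i) F i v) u = \sum_(i <- r | P i) 'D_w (F i) u.
Proof.
move=> dF; elim: r => [|i r IH].
  rewrite (_ : (fun _ => _) = cst 0) ?derive_cst ?big_nil//.
  by apply/funext => v; rewrite big_nil.
rewrite big_cons; case: (boolP (P i)) => [Pi|nPi].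
  rewrite (_ : (fun _ => _) = F i + (fun v => \sum_(i <- r | P i) F i v)).
    rewrite deriveD ?IH//; apply: diff_derivable; first exact: dF.
    exact: differentiable_bigsum.
  by apply/funext => v; rewrite big_cons Pi.
rewrite (_ : (fun _ => _) = (fun v => \sum_(i <- r | P i) F i v)) //.
by apply/funext => v; rewrite big_cons (negbTE nPi).
Qed.

(** * Smooth maps *)

Section Ck.
Variable (R : realType).
Implicit Types (V W : normedModType R).

(** Openness of U matters: values on U determine the directional derivatives on
    U only then.  Every rule below that identifies a derivative on U relies on
    this. *)
Lemma Ck_ext V W k (U : set V) (f g : V -> W) : open U ->
  (forall u, U u -> f u = g u) -> Ck k U f -> Ck k U g.
Proof.
move=> oU; elim: k f g => [|k IH] f g fg /=.
  move=> cf u Uu; have nfg : {near u, f =1 g}.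
    by near=> w; apply: fg; near: w; exact: open_nbhs_nbhs.
  rewrite /prop_for /continuous_at -fg//.
  by apply: cvg_trans (cf u Uu); apply: near_eq_cvg; exact: nfg.
move=> [df Df].
have nfg u : U u -> {near u, f =1 g}.
  by move=> Uu; near=> w; apply: fg; near: w; exact: open_nbhs_nbhs.
split=> [u Uu|v].
  by apply: near_eq_differentiable (df u Uu); exact: nfg.
apply: IH (Df v) => u Uu; apply: near_eq_derive; exact: nfg.
Unshelve. all: by end_near. Qed.

Lemma Ck_le V W k (U : set V) (f : V -> W) : Ck k.+1 U f -> Ck k U f.
Proof.
elim: k f => [|k IH] f /=.
  by move=> [df _] u Uu; exact: differentiable_continuous (df u Uu).
by move=> [df Df]; split=> // v; apply: IH; exact: Df.
Qed.

Lemma Ck_cst V W k (U : set V) (w : W) : Ck k U (cst w).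
Proof.
elim: k w => [|k IH] w /=; first by move=> u Uu; exact: cst_continuous.
split=> [u Uu|v]; first exact: differentiable_cst.
suff -> : 'D_v (cst w : V -> W) = cst 0 by exact: IH.
by apply/funext => u; exact: derive_cst.
Qed.

Lemma CkD V W k (U : set V) (f g : V -> W) : open U ->
  Ck k U f -> Ck k U g -> Ck k U (fun u => f u + g u).
Proof.
move=> oU; elim: k f g => [|k IH] f g /=.
  by move=> cf cg u Uu; apply: continuousD; [exact: cf|exact: cg].
move=> [df Df] [dg Dg]; split=> [u Uu|v].
  by apply: (differentiableD (f := f)); [exact: df|exact: dg].
apply: (Ck_ext oU _ (IH _ _ (Df v) (Dg v))) => u Uu.
by rewrite [RHS]deriveD//; apply: diff_derivable; [exact: df|exact: dg].
Qed.

(** Induction on k: the derivative of a *: f is a sum of two products of maps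
    of class C^k, where the class of the undifferentiated factor is lowered by
    [Ck_le]. *)
Lemma Ck_scale V W k (U : set V) (a : V -> R^o) (f : V -> W) : open U ->
  Ck k U a -> Ck k U f -> Ck k U (fun u => a u *: f u).
Proof.
move=> oU; elim: k a f => [|k IH] a f.
  by move=> /= cf cg u Uu; apply: continuousZ; [exact: cf|exact: cg].
move=> Ca Cf; have [da Da] := Ca; have [df Df] := Cf.
split=> [u Uu|v].
  by apply: differentiable_scale; [exact: da|exact: df].
apply: (Ck_ext oU _ (CkD oU (IH _ _ (Da v) (Ck_le Cf)) (IH _ _ (Ck_le Ca) (Df v)))).
by move=> u Uu; rewrite derive_scale//; [exact: da|exact: df].
Qed.

Lemma Ck_lin V W (W' : normedModType R) (L : {linear W -> W'}) k (U : set V)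
  (f : V -> W) : open U -> continuous L -> Ck k U f -> Ck k U (L \o f).
Proof.
move=> oU cL; elim: k f => [|k IH] f.
  by move=> /= cf u Uu; apply: continuous_comp; [exact: cf|exact: cL].
move=> [df Df]; split=> [u Uu|v].
  by apply: differentiable_comp; [exact: df|exact: linear_differentiable].
apply: (Ck_ext oU _ (IH _ (Df v))) => u Uu /=.
by rewrite derive_lin//; exact: df.
Qed.

(** The chain rule for curves: D_v (g o s) = (D_v s) g'(s), so one induction on
    k suffices once products are known to be smooth. *)
Lemma Ck_curve V W k (U : set V) (I : set R^o) (g : R^o -> W) (s : V -> R^o) :
  open U -> (forall u, U u -> I (s u)) ->
  Ck k I g -> Ck k U s -> Ck k U (g \o s).
Proof.
move=> oU Us; elim: k g => [|k IH] g.
  by move=> /= cg cs u Uu; apply: continuous_comp; [exact: cs|apply: cg; exact: Us].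
move=> [dg Dg] Cs; have [ds Ds] := Cs; split=> [u Uu|v].
  by apply: differentiable_comp; [exact: ds|apply: dg; exact: Us].
apply: (Ck_ext oU _ (Ck_scale oU (Ds v) (IH _ (Dg 1) (Ck_le Cs)))) => u Uu /=.
by rewrite derive_curve//; [exact: ds|apply: dg; exact: Us].
Qed.

Lemma Ck_sum V W k (U : set V) (I : Type) (r : seq I) (P : pred I)
    (F : I -> V -> W) :
  open U -> (forall i, P i -> Ck k U (F i)) -> Ck k U (fun u => \sum_(i <- r | P i) F i u).
Proof.
move=> oU CF; elim: r => [|i r IH].
  by apply: (Ck_ext oU _ (@Ck_cst _ _ k U 0)) => u _; rewrite big_nil.
case: (boolP (P i)) => [Pi|nPi].
  by apply: (Ck_ext oU _ (CkD oU (CF i Pi) IH)) => u _; rewrite big_cons Pi.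
by apply: (Ck_ext oU _ IH) => u _; rewrite big_cons (negbTE nPi).
Qed.

Lemma CkM V k (U : set V) (f g : V -> R^o) :
  open U -> Ck k U f -> Ck k U g -> Ck k U (fun u => f u * g u : R^o).
Proof. exact: Ck_scale. Qed.

Lemma Ck_prod V k (U : set V) (I : Type) (r : seq I) (P : pred I)
    (F : I -> V -> R^o) :
  open U -> (forall i, P i -> Ck k U (F i)) ->
  Ck k U (fun u => \prod_(i <- r | P i) F i u : R^o).
Proof.
move=> oU CF; elim: r => [|i r IH].
  by apply: (Ck_ext oU _ (@Ck_cst _ _ k U (1 : R^o))) => u _; rewrite big_nil.
case: (boolP (P i)) => [Pi|nPi].
  by apply: (Ck_ext oU _ (CkM oU (CF i Pi) IH)) => u _; rewrite big_cons Pi.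
by apply: (Ck_ext oU _ IH) => u _; rewrite big_cons (negbTE nPi).
Qed.

(** The derivative of the inverse is - (1/x)^2, a product of functions already
    known to be C^k. *)
Lemma Ck_Rinv k : Ck k ([set x | x != 0] : set R^o) (fun x : R^o => x^-1 : R^o).
Proof.
have oU : open ([set x | x != 0] : set R^o) by exact: open_neq.
elim: k => [|k IH].
  by move=> u /= u0; exact: inv_continuous.
split=> [u /= u0|v]; first exact: differentiable_Rinv.
apply: (Ck_ext oU _ (CkM oU (@Ck_cst _ _ k _ (- v : R^o)) (CkM oU IH IH))) => u /= u0.
have dv : differentiable (fun x : R^o => x^-1 : R^o) u by exact: differentiable_Rinv.
rewrite deriveE// diff_Rinv//= /cst -expr2.
by rewrite [RHS]mulrC mulrN mulNr exprVn.
Qed.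

Lemma CkV V k (U : set V) (f : V -> R^o) : open U ->
  (forall u, U u -> f u != 0) -> Ck k U f -> Ck k U (fun u => (f u)^-1 : R^o).
Proof. by move=> oU f0 Cf; exact: (Ck_curve oU f0 (Ck_Rinv k) Cf). Qed.

(** The derivative of the square root is the inverse of twice the square
    root, so smoothness reproduces itself. *)
Lemma Ck_sqrt_pos k :
  Ck k ([set x | 0 < x] : set R^o) (fun x : R^o => Num.sqrt x : R^o).
Proof.
have oU : open ([set x | 0 < x] : set R^o) by exact: open_gt.
have ds (u : R^o) : 0 < u -> differentiable (fun x : R^o => Num.sqrt x : R^o) u.
  by move=> u0; apply/derivable1_diffP; have [] := is_derive1_sqrt u0.
elim: k => [|k IH].
  by move=> u /= u0; exact: sqrt_continuous.
split=> [u /= u0|v]; first exact: ds.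
have s0 (u : R^o) : 0 < u -> Num.sqrt u != 0 by move=> ?; rewrite gt_eqF// sqrtr_gt0.
apply: (Ck_ext oU _ (CkM oU (@Ck_cst _ _ k _ (v / 2 : R^o)) (CkV oU s0 IH))) => u /= u0.
rewrite /cst -[in RHS](mulr1 v) -[X in 'D_X _ _]/(v *: (1 : R^o)).
rewrite deriveE; last exact: ds.
rewrite linearZ /= -deriveE; last exact: ds.
by rewrite derive_sqrt// invfM -mulrA.
Qed.

Lemma Ck_sqrt V k (U : set V) (f : V -> R^o) : open U ->
  (forall u, U u -> 0 < f u) -> Ck k U f -> Ck k U (fun u => Num.sqrt (f u) : R^o).
Proof. by move=> oU f0 Cf; exact: (Ck_curve oU f0 (Ck_sqrt_pos k) Cf). Qed.

Lemma Ck_det V k m (U : set V) (A : V -> 'M[R]_m) : open U ->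
  (forall i j, Ck k U (fun u => A u i j : R^o)) -> Ck k U (fun u => \det (A u) : R^o).
Proof.
move=> oU CA; rewrite /determinant; apply: Ck_sum => // s _.
apply: CkM => //; first exact: Ck_cst.
exact: Ck_prod.
Qed.

(** Cramer's rule: the entries of the inverse are cofactors divided by the
    determinant. *)
Lemma Ck_invmx V k m (U : set V) (A : V -> 'M[R]_m) : open U ->
  (forall u, U u -> A u \in unitmx) ->
  (forall i j, Ck k U (fun u => A u i j : R^o)) ->
  forall i j, Ck k U (fun u => invmx (A u) i j : R^o).
Proof.
move=> oU Au CA i j.
have Cadj : Ck k U (fun u => \adj (A u) i j : R^o).
  apply: (Ck_ext oU (f := fun u => (-1) ^+ (j + i) * \det (row' j (col' i (A u))))).
    by move=> u _; rewrite mxE.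
  apply: CkM => //; first exact: Ck_cst.
  apply: Ck_det => // a b.
  by apply: Ck_ext (CA (lift j a) (lift i b)) => // u _; rewrite !mxE.
have Cdet : Ck k U (fun u => (\det (A u))^-1 : R^o).
  by apply: CkV => // [u /Au|]; [rewrite unitmxE unitfE|exact: Ck_det].
by apply: (Ck_ext oU _ (CkM oU Cdet Cadj)) => u /Au Uu; rewrite /invmx Uu [RHS]mxE.
Qed.

Lemma Ck_coord V m k (U : set V) (f : V -> 'rV[R]_m) (i : 'I_m) : open U ->
  Ck k U f -> Ck k U (fun u => f u 0 i : R^o).
Proof.
move=> oU Cf.
have lin : linear (fun x : 'rV[R]_m => x 0 i : R^o) by move=> a x y; rewrite !mxE.
pose gM := GRing.isLinear.Build _ _ _ _ _ lin.
pose L : {linear 'rV[R]_m -> R^o} := HB.pack (fun x : 'rV[R]_m => x 0 i : R^o) gM.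
by apply: (Ck_lin (L := L)) => //; exact: coord_continuous.
Qed.

Lemma smooth_differentiable V W (U : set V) (f : V -> W) u :
  smooth U f -> U u -> differentiable f u.
Proof. by move=> /(_ 1) [df _] /df. Qed.

Lemma smooth_derive V W (U : set V) (f : V -> W) v :
  smooth U f -> smooth U ('D_v f).
Proof. by move=> Cf k; have [_] := Cf k.+1; apply. Qed.

End Ck.

Lemma CkB (R : realType) (V W : normedModType R) k (U : set V) (f g : V -> W) :
  open U -> Ck k U f -> Ck k U g -> Ck k U (fun u => f u - g u).
Proof.
move=> oU Cf Cg; apply: CkD => //.
apply: (Ck_ext oU _ (Ck_scale oU (@Ck_cst _ _ _ k U (-1 : R^o)) Cg)) => u _.
by rewrite /cst scaleN1r.
Qed.

Lemma smooth_ext (R : realType) (V W : normedModType R) (U : set V) (f g : V -> W) :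
  open U -> (forall u, U u -> f u = g u) -> smooth U f -> smooth U g.
Proof. by move=> oU fg Cf k; exact: Ck_ext (Cf k). Qed.

Lemma smoothD (R : realType) (V W : normedModType R) (U : set V) (f g : V -> W) :
  open U -> smooth U f -> smooth U g -> smooth U (fun u => f u + g u).
Proof. by move=> oU Sf Sg k; apply: CkD. Qed.

Lemma smoothB (R : realType) (V W : normedModType R) (U : set V) (f g : V -> W) :
  open U -> smooth U f -> smooth U g -> smooth U (fun u => f u - g u).
Proof. by move=> oU Sf Sg k; apply: CkB. Qed.

Lemma smooth_scale (R : realType) (V W : normedModType R) (U : set V)
    (a : V -> R^o) (f : V -> W) :
  open U -> smooth U a -> smooth U f -> smooth U (fun u => a u *: f u).
Proof. by move=> oU Sa Sf k; apply: Ck_scale. Qed.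

Lemma smooth_coord (R : realType) (V : normedModType R) m (U : set V)
    (f : V -> 'rV[R]_m) i : open U -> smooth U f -> smooth U (fun u => f u 0 i : R^o).
Proof. by move=> oU Sf k; exact: Ck_coord. Qed.

Lemma smooth_curve (R : realType) (V W : normedModType R) (J : set R) (U : set V)
    (f : R -> W) (s : V -> R) :
  open U -> (forall u, U u -> J (s u)) ->
  smooth (J : set R^o) (f : R^o -> W) -> smooth U (s : _ -> R^o) ->
  smooth U (f \o s).
Proof. by move=> oU Js Sf Ss k; apply: Ck_curve oU Js (Sf k) (Ss k). Qed.

Lemma smooth_derive1 (R : realType) (W : normedModType R) (J : set R) (f : R -> W) :
  open J -> smooth (J : set R^o) (f : R^o -> W) ->
  smooth (J : set R^o) (derive1 f : R^o -> W).
Proof.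
move=> oJ Sf; apply: smooth_ext (smooth_derive (1 : R^o) Sf) => // s Js.
by rewrite derive1E.
Qed.

(** * Mean values and the symmetry of second derivatives *)

Lemma derive_along_line (R : realType) (V : normedModType R) (f : V -> R^o)
    (u v : V) (t : R) :
  differentiable f (u + t *: v) ->
  is_derive t 1 (fun s : R => f (u + s *: v) : R) ('D_v f (u + t *: v)).
Proof.
move=> df; pose l := fun s : R^o => u + s *: v.
have dl : differentiable l t by [].
have dfl : differentiable (f \o l) t by exact: differentiable_comp.
have il : is_diff t l (0 + ( *:%R^~ v)) by exact: is_diffD.
have e : 'D_(1 : R^o) (f \o l) t = 'D_v f (u + t *: v).
  rewrite deriveE// diff_comp//= deriveE//; congr ('d f _ _).
  by rewrite diff_val -[RHS]scale1r -[RHS]add0r.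
by apply: DeriveDef; [exact: diff_derivable dfl|exact: e].
Qed.

Lemma MVT_line (R : realType) (V : normedModType R) (f : V -> R^o)
    (u v : V) (h : R) : 0 <= h ->
  (forall t, 0 <= t <= h -> differentiable f (u + t *: v)) ->
  exists2 c, 0 <= c <= h & f (u + h *: v) - f u = 'D_v f (u + c *: v) * h.
Proof.
move=> h0 df.
pose F : R -> R := fun s => f (u + s *: v).
pose dF : R -> R := fun s => 'D_v f (u + s *: v).
have D (t : R) : t \in `[0, h] -> is_derive t 1 F (dF t).
  by rewrite in_itv/= => th; apply: derive_along_line; exact: df.
have D' (t : R) : t \in `]0, h[ -> is_derive t 1 F (dF t).
  by move=> /subset_itv_oo_cc; exact: D.
have cF : {within `[0, h], continuous F}.
  by apply: derivable_within_continuous => t /D [].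
have [c ch e] := MVT_segment h0 D' cF.
exists c; first by rewrite in_itv/= in ch.
by move: e; rewrite /F /dF subr0 scale0r addr0.
Qed.

(** The mean value theorem on the segment from the centre to y. *)
Lemma derive_zero_const (R : realType) (V : normedModType R) (s : V -> R^o)
    (u : V) (r : R) : 0 < r ->
  (forall y, ball u r y -> differentiable s y /\ forall v, 'D_v s y = 0) ->
  forall y, ball u r y -> s y = s u.
Proof.
move=> r0 H y By.
have B t : 0 <= t <= 1 -> ball u r (u + t *: (y - u)).
  move=> /andP[t0 t1]; move: By; rewrite -!ball_normE /= opprD addNKr normrN.
  by rewrite normrZ ger0_norm// distrC; apply: le_lt_trans; rewrite ler_piMl.
have dt t : 0 <= t <= 1 -> differentiable s (u + t *: (y - u)).
  by move=> /B /H [].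
have [c /B /H [_ H0] e] := MVT_line ler01 dt.
move: e; rewrite H0 mul0r scale1r subrKC => /eqP.
by rewrite subr_eq0 => /eqP.
Qed.

(** Two applications of the mean value theorem: first to
    y |-> f (y + h w) - f y along v, then to D_v f along w. *)
Lemma second_difference (R : realType) (V : normedModType R) (f : V -> R^o)
    (u v w : V) (h : R) : 0 <= h ->
  (forall s t, 0 <= s <= h -> 0 <= t <= h ->
     differentiable f (u + s *: v + t *: w) /\
     differentiable ('D_v f : V -> R^o) (u + s *: v + t *: w)) ->
  exists s t, [/\ 0 <= s <= h, 0 <= t <= h &
    f (u + h *: v + h *: w) - f (u + h *: v) - f (u + h *: w) + f u =
    'D_w ('D_v f : V -> R^o) (u + s *: v + t *: w) * h ^+ 2].
Proof.
move=> h0 df.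
have hh : 0 <= h <= h by rewrite h0 lexx.
have z0 : 0 <= (0 : R) <= h by rewrite lexx.
pose fw : V -> R^o := fun y => f (y + h *: w).
pose g : V -> R^o := fw - f.
have dfw y : differentiable f (y + h *: w) -> differentiable fw y.
  by move=> d; exact: (@differentiable_comp _ _ _ _ (fun x => x + h *: w) f).
have dg s : 0 <= s <= h -> differentiable g (u + s *: v).
  move=> sh; apply: differentiableB.
    by apply: dfw; have [] := df _ _ sh hh.
  by have [] := df _ _ sh z0; rewrite scale0r addr0.
have [s sh e1] := MVT_line h0 dg.
have dh t : 0 <= t <= h -> differentiable ('D_v f : V -> R^o) (u + s *: v + t *: w).
  by move=> th; have [] := df _ _ sh th.
have [t th e2] := MVT_line h0 dh.
exists s, t; split=> //.
have -> : f (u + h *: v + h *: w) - f (u + h *: v) - f (u + h *: w) + f u =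
          g (u + h *: v) - g u.
  rewrite [RHS](_ : _ = fw (u + h *: v) - f (u + h *: v) - (fw u - f u))//.
  by rewrite /fw opprB addrA addrAC.
rewrite e1 expr2 mulrA -e2; congr (_ * _).
have d1 : differentiable f (u + s *: v + h *: w) by have [] := df _ _ sh hh.
have d0 : differentiable f (u + s *: v).
  by have [] := df _ _ sh z0; rewrite scale0r addr0.
rewrite /g deriveB; [|by apply: diff_derivable; exact: dfw|exact: diff_derivable].
congr (_ - _); rewrite (deriveE _ d1) (deriveE _ (dfw _ d1)).
rewrite (@diff_comp _ _ _ _ (fun x => x + h *: w) f)//=; congr ('d f _ _).
have il : is_diff (u + s *: v) (fun x => x + h *: w) (id + 0) by exact: is_diffD.
by rewrite diff_val -[RHS]addr0.
Qed.

Lemma ler_distD_half (R : realType) (e a b c : R) :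
  `|a - c| < e / 2 -> `|b - c| < e / 2 -> `|b - a| <= e.
Proof.
move=> ac bc; rewrite -(subrKA c) (le_trans (ler_normD _ _))// (splitr e).
by rewrite lerD// ltW// distrC.
Qed.

(** Schwarz's theorem.  The second difference is symmetric in v and w; divided
    by h^2 it is a value of D_w (D_v f) and also a value of D_v (D_w f), both at
    points close to u. *)
Lemma derive_comm (R : realType) (V : normedModType R) (U : set V) (f : V -> R^o)
    (u v w : V) : open U -> smooth U f -> U u ->
  'D_v ('D_w f : V -> R^o) u = 'D_w ('D_v f : V -> R^o) u.
Proof.
move=> oU Sf Uu; apply/eqP; rewrite -subr_eq0 -normr_le0.
have Sfv := smooth_derive v Sf; have Sfw := smooth_derive w Sf.
have cvw := smooth_derive w Sfv 0 _ Uu; have cwv := smooth_derive v Sfw 0 _ Uu.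
apply/ler_addgt0Pl => e e0; rewrite addr0.
have e20 : 0 < e / 2 by rewrite divr_gt0.
pose P1 : set V := [set y |
  `|'D_w ('D_v f : V -> R^o) u - 'D_w ('D_v f : V -> R^o) y| < e / 2].
pose P2 : set V := [set y |
  `|'D_v ('D_w f : V -> R^o) u - 'D_v ('D_w f : V -> R^o) y| < e / 2].
have N1 : nbhs u P1 by move/cvgrPdist_lt : cvw; apply.
have N2 : nbhs u P2 by move/cvgrPdist_lt : cwv; apply.
have N3 : nbhs u U by exact: open_nbhs_nbhs.
have [r /= r0 Hr] := (nbhs_ballP _ _).1 (filterI N3 (filterI N1 N2)).
(* this h keeps the whole parallelogram spanned by h v and h w inside the ball *)
pose h := r / (`|v| + `|w| + 1) / 2.
have p0 : 0 < `|v| + `|w| + 1 by rewrite ltr_wpDl ?addr_ge0.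
have h0 : 0 < h by rewrite !divr_gt0.
have hr s t : 0 <= s <= h -> 0 <= t <= h -> ball u r (u + s *: v + t *: w).
  move=> /andP[s0 sh] /andP[t0 th].
  rewrite -ball_normE /= -addrA opprD addrA subrr sub0r normrN.
  rewrite (le_lt_trans (ler_normD _ _))// !normrZ !ger0_norm//.
  have : s * `|v| + t * `|w| <= h * (`|v| + `|w| + 1).
    by rewrite !mulrDr mulr1 -[leLHS]addr0 lerD ?(ltW h0)// lerD// ler_wpM2r.
  move=> /le_lt_trans; apply.
  by rewrite /h mulrAC divfK ?gt_eqF// ltr_pdivrMr// ltr_pMr// ltr1n.
have [|s [t [sh th e1]]] := @second_difference R V f u v w h (ltW h0).
  move=> s t sh th; have [Uy _] := Hr _ (hr _ _ sh th).
  by split; exact: smooth_differentiable Uy.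
have [|s' [t' [sh' th' e2]]] := @second_difference R V f u w v h (ltW h0).
  move=> s' t' sh' th'; have := hr _ _ th' sh'; rewrite addrAC => /Hr [Uy _].
  by split; exact: smooth_differentiable Uy.
have e3 : 'D_w ('D_v f : V -> R^o) (u + s *: v + t *: w) =
          'D_v ('D_w f : V -> R^o) (u + s' *: w + t' *: v).
  have hn : h ^+ 2 != 0 by rewrite expf_neq0// gt_eqF.
  have e12 : f (u + h *: v + h *: w) - f (u + h *: v) - f (u + h *: w) =
             f (u + h *: w + h *: v) - f (u + h *: w) - f (u + h *: v).
    by rewrite (addrAC u (h *: v)); exact: addrAC.
  by apply: (mulIf hn); exact: etrans (esym e1) (etrans (congr1 (+%R^~ (f u)) e12) e2).
have [_ [H1 _]] := Hr _ (hr _ _ sh th).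
have [_ [_ H2]] := Hr _ (hr _ _ th' sh').
rewrite addrAC in H2.
rewrite /P1 /P2 /= in H1 H2; rewrite e3 in H1.
exact: ler_distD_half H1 H2.
Qed.

Lemma derive_comm_row (R : realType) (V : normedModType R) m (U : set V)
    (f : V -> 'rV[R]_m) (u v w : V) : open U -> smooth U f -> U u ->
  'D_v ('D_w f) u = 'D_w ('D_v f) u.
Proof.
move=> oU Sf Uu; apply/rowP => i.
have dd a : differentiable ('D_a f) u.
  exact: smooth_differentiable (smooth_derive a Sf) Uu.
apply: etrans (esym (derive_coord v i (dd w))) (etrans _ (derive_coord w i (dd v))).
have E a x : U x -> 'D_a f x 0 i = 'D_a (fun x => f x 0 i : R^o) x.
  by move=> Ux; rewrite derive_coord//; exact: smooth_differentiable Ux.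
apply: etrans (near_eq_derive_open v oU Uu (E w)) _.
apply: etrans _ (esym (near_eq_derive_open w oU Uu (E v))).
exact: (derive_comm v w oU (smooth_coord i oU Sf) Uu).
Qed.

(** * The Minkowski product *)

Lemma mdotC (R : realType) n (x y : 'rV[R]_n.+1) : mdot x y = mdot y x.
Proof.
by rewrite /mdot mulrC; congr (_ - _); apply: eq_bigr => i _; rewrite mulrC.
Qed.

Lemma mdotDl (R : realType) n (x y z : 'rV[R]_n.+1) :
  mdot (x + y) z = mdot x z + mdot y z.
Proof.
rewrite /mdot mxE mulrDl opprD addrACA -big_split/=; congr (_ + _).
by apply: eq_bigr => i _; rewrite mxE mulrDl.
Qed.

Lemma mdotZl (R : realType) n a (x z : 'rV[R]_n.+1) :
  mdot (a *: x) z = a * mdot x z.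
Proof.
rewrite /mdot mxE mulrBr mulrA mulr_sumr; congr (_ - _).
by apply: eq_bigr => i _; rewrite mxE mulrA.
Qed.

Lemma mdotDr (R : realType) n (x y z : 'rV[R]_n.+1) :
  mdot z (x + y) = mdot z x + mdot z y.
Proof. by rewrite mdotC mdotDl !(mdotC z). Qed.

Lemma mdotZr (R : realType) n a (x z : 'rV[R]_n.+1) :
  mdot z (a *: x) = a * mdot z x.
Proof. by rewrite mdotC mdotZl mdotC. Qed.

Lemma mdotNl (R : realType) n (x z : 'rV[R]_n.+1) : mdot (- x) z = - mdot x z.
Proof. by rewrite -scaleN1r mdotZl mulN1r. Qed.

Lemma mdotNr (R : realType) n (x z : 'rV[R]_n.+1) : mdot z (- x) = - mdot z x.
Proof. by rewrite mdotC mdotNl mdotC. Qed.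

Lemma mdotBl (R : realType) n (x y z : 'rV[R]_n.+1) :
  mdot (x - y) z = mdot x z - mdot y z.
Proof. by rewrite mdotDl mdotNl. Qed.

Lemma mdotBr (R : realType) n (x y z : 'rV[R]_n.+1) :
  mdot z (x - y) = mdot z x - mdot z y.
Proof. by rewrite mdotDr mdotNr. Qed.

Lemma mdot0l (R : realType) n (z : 'rV[R]_n.+1) : mdot 0 z = 0.
Proof. by rewrite -(scale0r (0 : 'rV[R]_n.+1)) mdotZl mul0r. Qed.

Lemma mdot0r (R : realType) n (z : 'rV[R]_n.+1) : mdot z 0 = 0.
Proof. by rewrite mdotC mdot0l. Qed.

Lemma mdot_suml (R : realType) n (I : Type) (r : seq I) (F : I -> 'rV[R]_n.+1) z :
  mdot (\sum_(i <- r) F i) z = \sum_(i <- r) mdot (F i) z.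
Proof.
elim: r => [|i r IH]; first by rewrite !big_nil mdot0l.
by rewrite !big_cons mdotDl IH.
Qed.

Lemma mdot_sumr (R : realType) n (I : Type) (r : seq I) (F : I -> 'rV[R]_n.+1) z :
  mdot z (\sum_(i <- r) F i) = \sum_(i <- r) mdot z (F i).
Proof. by rewrite mdotC mdot_suml; apply: eq_bigr => i _; rewrite mdotC. Qed.

Lemma mdot_nondeg (R : realType) n (x : 'rV[R]_n.+1) :
  (forall y, mdot x y = 0) -> x = 0.
Proof.
move=> H; apply/rowP => j; rewrite mxE.
have := H (delta_mx 0 j); rewrite /mdot.
case: (unliftP ord_max j) => [k|] ->.
  rewrite (bigD1 k)//= big1 => [|i ik].
    by rewrite !mxE !eqxx eq_liftF /= mulr1 mulr0 addr0 subr0.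
  by rewrite mxE (inj_eq lift_inj) (negbTE ik) andbF mulr0.
rewrite big1 => [|i _]; last by rewrite mxE lift_eqF andbF mulr0.
by rewrite mxE !eqxx mulr1 sub0r => /eqP; rewrite oppr_eq0 => /eqP.
Qed.

(** Bessel's identity for two orthonormal vectors x and y. *)
Lemma mdot_residual (R : realType) n (x y c : 'rV[R]_n.+1) :
  mdot x x = 1 -> mdot y y = 1 -> mdot x y = 0 -> mdot c c = 1 ->
  mdot (c - mdot c x *: x - mdot c y *: y) (c - mdot c x *: x - mdot c y *: y) =
  1 - mdot c x ^+ 2 - mdot c y ^+ 2.
Proof.
move=> xx yy xy cc; rewrite !(mdotBl, mdotBr, mdotZl, mdotZr).
by rewrite (mdotC x c) (mdotC y c) (mdotC y x) xx yy xy cc; ring.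
Qed.

Lemma derive_mdot (R : realType) n (V : normedModType R)
    (f g : V -> 'rV[R]_n.+1) u w :
  differentiable f u -> differentiable g u ->
  'D_w (fun v => mdot (f v) (g v) : R^o) u =
    mdot ('D_w f u) (g u) + mdot (f u) ('D_w g u).
Proof.
move=> df dg; rewrite /mdot.
have dc i : differentiable (fun v => f v 0 i * g v 0 i : R^o) u.
  by apply: differentiable_scale; exact: differentiable_coordinate.
have ec i : 'D_w (fun v => f v 0 i * g v 0 i : R^o) u =
    'D_w f u 0 i * g u 0 i + f u 0 i * 'D_w g u 0 i.
  rewrite derive_scale; try exact: differentiable_coordinate.
  by rewrite !derive_coord.
rewrite (deriveB (f := fun v => \sum_(i < n) _ : R^o)); last 2 first.
- by apply: diff_derivable; exact: differentiable_bigsum.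
- exact: diff_derivable.
rewrite derive_bigsum// ec opprD addrACA -big_split/=.
by congr (_ + _); apply: eq_bigr => i _; rewrite ec.
Qed.

Lemma smooth_mdot (R : realType) n (V : normedModType R) (U : set V)
    (f g : V -> 'rV[R]_n.+1) : open U -> smooth U f -> smooth U g ->
  smooth U (fun v => mdot (f v) (g v) : R^o).
Proof.
move=> oU Cf Cg k; rewrite /mdot.
have Cc i : Ck k U (fun v => f v 0 i * g v 0 i : R^o).
  by apply: CkM => //; apply: Ck_coord.
apply: CkD => //; first exact: Ck_sum.
apply: (Ck_ext oU _ (CkM oU (@Ck_cst _ _ _ k U (-1 : R^o)) (Cc ord_max))) => u _.
by rewrite /cst mulN1r.
Qed.

(** * Coordinate frames and partial derivatives *)

(** The coordinate field X_i.  Iterates are higher derivatives: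
    [frame (frame X j) i] is the second derivative X_ij.  The definition is sealed
    so that iterated frames are compared by their indices, not by unfolding. *)
HB.lock Definition frame (R : realType) n m (X : 'rV[R]_n -> 'rV[R]_m) (i : 'I_n) :=
  'D_(delta_mx 0 i) X.

Lemma smooth_frame (R : realType) n m (U : set 'rV[R]_n)
    (X : 'rV[R]_n -> 'rV[R]_m) i : smooth U X -> smooth U (frame X i).
Proof. by rewrite frame.unlock; exact: smooth_derive. Qed.

Lemma frame_comm (R : realType) n m (U : set 'rV[R]_n)
    (X : 'rV[R]_n -> 'rV[R]_m) i j u : open U -> smooth U X -> U u ->
  frame (frame X i) j u = frame (frame X j) i u.
Proof. by move=> oU SX Uu; rewrite frame.unlock; exact: derive_comm_row SX Uu. Qed.

Lemma partial_eq_open (R : realType) n (U : set 'rV[R]_n) (f g : 'rV[R]_n -> R) i u :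
  open U -> U u -> (forall x, U x -> f x = g x) -> partial i f u = partial i g u.
Proof. by move=> oU Uu fg; exact: near_eq_derive_open fg. Qed.

Lemma partial_cst (R : realType) n (c : R) i (u : 'rV[R]_n) :
  partial i (fun=> c) u = 0.
Proof. exact: derive_cst. Qed.

Lemma partialN (R : realType) n (a : 'rV[R]_n -> R) i u :
  differentiable (a : _ -> R^o) u ->
  partial i (fun v => - a v) u = - partial i a u.
Proof. by move=> da; exact: (deriveN (diff_derivable da)). Qed.

Lemma partialM (R : realType) n (a b : 'rV[R]_n -> R) i u :
  differentiable (a : _ -> R^o) u -> differentiable (b : _ -> R^o) u ->
  partial i (fun v => a v * b v) u = partial i a u * b u + a u * partial i b u.
Proof. by move=> da db; exact: (derive_scale _ da db). Qed.

Lemma partial_sum_mul (R : realType) n (m : nat) (a b : 'I_m -> 'rV[R]_n -> R) i u :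
  (forall l, differentiable (a l : _ -> R^o) u) ->
  (forall l, differentiable (b l : _ -> R^o) u) ->
  partial i (fun v => \sum_l a l v * b l v) u =
    \sum_l partial i (a l) u * b l u + \sum_l a l u * partial i (b l) u.
Proof.
move=> da db; rewrite -big_split/= /partial derive_bigsum.
  by apply: eq_bigr => l _; exact: derive_scale (da l) (db l).
by move=> l _; exact: differentiable_scale (da l) (db l).
Qed.

Lemma partial_mdot (R : realType) n (Y Z : 'rV[R]_n -> 'rV[R]_n.+1) i u :
  differentiable Y u -> differentiable Z u ->
  partial i (fun v => mdot (Y v) (Z v)) u =
    mdot (frame Y i u) (Z u) + mdot (Y u) (frame Z i u).
Proof. by move=> dY dZ; rewrite frame.unlock; exact: derive_mdot. Qed.

Lemma partial_curve (R : realType) n (J : set R) (U : set 'rV[R]_n)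
    (f : R -> R) (s : 'rV[R]_n -> R) i u :
  smooth (J : set R^o) (f : R^o -> R^o) -> smooth U (s : _ -> R^o) ->
  J (s u) -> U u ->
  partial i (f \o s) u = partial i s u * derive1 f (s u).
Proof.
move=> Sf Ss Js Uu; rewrite /partial derive1E.
apply: (derive_curve (g := f : R^o -> R^o) (s := s : _ -> R^o)).
  exact: smooth_differentiable Uu.
exact: smooth_differentiable Js.
Qed.

Lemma frame_curve (R : realType) n m (J : set R) (U : set 'rV[R]_n)
    (f : R -> 'rV[R]_m) (s : 'rV[R]_n -> R) i u :
  smooth (J : set R^o) (f : R^o -> 'rV[R]_m) -> smooth U (s : _ -> R^o) ->
  J (s u) -> U u ->
  frame (f \o s) i u = partial i s u *: derive1 f (s u).
Proof.
move=> Sf Ss Js Uu; rewrite frame.unlock /partial derive1E.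
apply: (derive_curve (g := f : R^o -> _) (s := s : _ -> R^o)).
  exact: smooth_differentiable Uu.
exact: smooth_differentiable Js.
Qed.

Lemma smooth_partial (R : realType) n (U : set 'rV[R]_n) (f : 'rV[R]_n -> R) i :
  smooth U (f : _ -> R^o) -> smooth U (partial i f : _ -> R^o).
Proof. exact: smooth_derive. Qed.

Lemma derive_partials (R : realType) n (s : 'rV[R]_n -> R) u v :
  differentiable (s : _ -> R^o) u -> (forall i, partial i s u = 0) ->
  'D_v (s : _ -> R^o) u = 0.
Proof.
move=> ds H; rewrite deriveE// [v]row_sum_delta linear_sum big1// => i _.
by rewrite linearZ/= -deriveE// [X in _ *: X]H scaler0.
Qed.

Lemma row_jacobian (R : realType) n m (X : 'rV[R]_n -> 'rV[R]_m) i u :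
  differentiable X u -> row i ('J X u) = frame X i u.
Proof. by move=> dX; rewrite frame.unlock deriveEjacobian// rowE. Qed.

Lemma mul_jacobian (R : realType) n m (X : 'rV[R]_n -> 'rV[R]_m) u x :
  differentiable X u -> x *m 'J X u = \sum_i x 0 i *: frame X i u.
Proof.
by move=> dX; rewrite mulmx_sum_row; apply: eq_bigr => i _; rewrite row_jacobian.
Qed.

(** * The induced metric and its Christoffel symbols *)

Lemma inducedE (R : realType) n (X : 'rV[R]_n -> 'rV[R]_n.+1) u i j :
  differentiable X u -> induced X u i j = mdot (frame X i u) (frame X j u).
Proof. by move=> dX; rewrite mxE !row_jacobian. Qed.

Lemma induced_sym (R : realType) n (X : 'rV[R]_n -> 'rV[R]_n.+1) u i j :
  induced X u i j = induced X u j i.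
Proof. by rewrite !mxE mdotC. Qed.

Lemma innerE (R : realType) n (g : 'rV[R]_n -> 'M[R]_n) u x y :
  inner g u x y = \sum_i \sum_j x 0 i * y 0 j * g u i j.
Proof.
rewrite /inner mxE exchange_big/=; apply: eq_bigr => j _.
by rewrite !mxE mulr_suml; apply: eq_bigr => i _; rewrite mulrAC.
Qed.

Lemma inner_mdot (R : realType) n (X : 'rV[R]_n -> 'rV[R]_n.+1) u x y :
  inner (induced X) u x y = mdot (x *m 'J X u) (y *m 'J X u).
Proof.
rewrite innerE !mulmx_sum_row mdot_suml; apply: eq_bigr => i _.
rewrite mdot_sumr; apply: eq_bigr => j _.
by rewrite mdotZl mdotZr mulrA mxE.
Qed.

(** A positive definite matrix has no kernel. *)
Lemma induced_unitmx (R : realType) n (X : 'rV[R]_n -> 'rV[R]_n.+1) u :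
  (forall x, x != 0 -> 0 < inner (induced X) u x x) -> induced X u \in unitmx.
Proof.
move=> pos; rewrite -row_free_unit -kermx_eq0; apply/rowV0P => v /sub_kermxP v0.
apply/eqP; apply: contraT => /pos; rewrite /inner v0 mul0mx mxE ltxx.
by [].
Qed.

Lemma smooth_induced (R : realType) n (U : set 'rV[R]_n)
    (X : 'rV[R]_n -> 'rV[R]_n.+1) i j : open U -> smooth U X ->
  smooth U (fun u => induced X u i j : R^o).
Proof.
move=> oU SX.
have := smooth_mdot oU (smooth_frame i SX) (smooth_frame j SX).
apply: smooth_ext => // u Uu; rewrite inducedE//; exact: smooth_differentiable Uu.
Qed.

Lemma partial_induced (R : realType) n (U : set 'rV[R]_n)
    (X : 'rV[R]_n -> 'rV[R]_n.+1) i j l u : open U -> smooth U X -> U u ->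
  partial i (fun v => induced X v j l) u =
    mdot (frame (frame X j) i u) (frame X l u) +
    mdot (frame X j u) (frame (frame X l) i u).
Proof.
move=> oU SX Uu; rewrite /partial.
rewrite (near_eq_derive_open (g := fun v => mdot (frame X j v) (frame X l v) : R^o) _ oU Uu).
  by apply: partial_mdot; apply: smooth_differentiable Uu; exact: smooth_frame.
by move=> x Ux; rewrite inducedE//; exact: smooth_differentiable Ux.
Qed.

(** The Christoffel symbols, with the upper index lowered, are the tangential
    components of X_ij.  Of the six products in d_i g_jl + d_j g_il - d_l g_ij four
    cancel by the symmetry of second derivatives. *)
Lemma christoffel_induced (R : realType) n (U : set 'rV[R]_n)
    (X : 'rV[R]_n -> 'rV[R]_n.+1) i j l u : open U -> smooth U X -> U u ->
  induced X u \in unitmx ->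
  \sum_k christoffel (induced X) k i j u * induced X u k l =
    mdot (frame (frame X j) i u) (frame X l u).
Proof.
move=> oU SX Uu gu; rewrite /christoffel.
pose B l := partial i (fun v => induced X v j l) u
  + partial j (fun v => induced X v i l) u - partial l (fun v => induced X v i j) u.
have BE : B l = 2 * mdot (frame (frame X j) i u) (frame X l u).
  rewrite /B !(partial_induced _ _ _ oU SX Uu).
  rewrite (frame_comm i j oU SX Uu) (frame_comm i l oU SX Uu) (frame_comm j l oU SX Uu).
  rewrite (mdotC (frame X j u)) (mdotC (frame X i u)).
  by ring.
transitivity (\sum_k (2^-1 * \sum_m invmx (induced X u) k m * B m) * induced X u k l).
  by [].
move: B BE => B BE.
transitivity (2^-1 * \sum_m (\sum_k induced X u l k * invmx (induced X u) k m) * B m).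
  rewrite mulr_sumr; under eq_bigr do rewrite -mulrA mulr_suml mulr_sumr.
  rewrite exchange_big/=; apply: eq_bigr => m _.
  rewrite mulr_suml mulr_sumr; apply: eq_bigr => k _.
  by rewrite (induced_sym X u l k); ring.
transitivity (2^-1 * B l); last by rewrite BE mulKf.
have D m : \sum_k induced X u l k * invmx (induced X u) k m = (l == m)%:R.
  by have := congr1 (fun M : 'M[R]_n => M l m) (mulmxV gu); rewrite !mxE.
congr (_ * _); under eq_bigr do rewrite D.
rewrite (bigD1 l)//= big1 => [|m /negbTE ml]; first by rewrite eqxx mul1r addr0.
by rewrite eq_sym ml mul0r.
Qed.

Lemma smooth_christoffel (R : realType) n (U : set 'rV[R]_n)
    (X : 'rV[R]_n -> 'rV[R]_n.+1) k i j : open U -> smooth U X ->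
  (forall u, U u -> induced X u \in unitmx) ->
  smooth U (christoffel (induced X) k i j : _ -> R^o).
Proof.
move=> oU SX gu q; apply: CkM => //; first exact: Ck_cst.
have Cg a b c : Ck q U (partial a (fun v => induced X v b c) : _ -> R^o).
  exact: smooth_partial (smooth_induced b c oU SX) q.
apply: Ck_sum => // l _; apply: CkM => //.
  by apply: Ck_invmx => // a b; exact: smooth_induced.
by apply: CkB => //; apply: CkD.
Qed.

(** * The Gauss equation *)

(** The rows of J span a positive definite subspace of dimension n, so a vector
    of negative square orthogonal to them completes a basis. *)
Lemma normal_spans (R : realType) n (J : 'M[R]_(n, n.+1)) (N : 'rV[R]_n.+1) :
  (forall x, x != 0 -> 0 < mdot (x *m J) (x *m J)) ->
  (forall i, mdot N (row i J) = 0) -> mdot N N < 0 ->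
  forall Y, exists c d, Y = c *m J + d *: N.
Proof.
move=> pos NJ NN Y.
have NJx x : mdot N (x *m J) = 0.
  rewrite mulmx_sum_row mdot_sumr big1// => i _.
  by rewrite mdotZr NJ mulr0.
have rf : row_free (col_mx J N).
  rewrite -kermx_eq0; apply/rowV0P => v /sub_kermxP.
  rewrite -[v]hsubmxK mul_row_col => e.
  have rN : rsubmx v *m N = rsubmx v 0 0 *: N.
    by rewrite {1}[rsubmx v]mx11_scalar mul_scalar_mx.
  have r0 : rsubmx v = 0.
    rewrite [rsubmx v]mx11_scalar.
    have := congr1 (mdot N) e; rewrite mdotDr NJx add0r rN mdotZr mdot0r.
    move/eqP; rewrite mulf_eq0 (lt_eqF NN) orbF => /eqP ->.
    exact: raddf0.
  have l0 : lsubmx v = 0.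
    move: e; rewrite r0 mul0mx addr0 => e; apply/eqP; apply: contraT => /pos.
    by rewrite e mdot0l ltxx.
  by rewrite l0 r0 row_mx0.
have : row_full (col_mx J N).
  by rewrite /row_full (eqP rf) addn1.
case/row_fullP => B BE; exists (lsubmx (Y *m B)), (rsubmx (Y *m B) 0 0).
rewrite -{1}[Y]mulmx1 -BE mulmxA -{1}[Y *m B]hsubmxK mul_row_col; congr (_ + _).
by rewrite {1}[rsubmx _]mx11_scalar mul_scalar_mx.
Qed.

(** The Gauss formula, paired with Z: if the coefficients c reproduce the
    products of Y with the tangent vectors, then Y is
    the tangent vector of components c minus (Y.N) N, the sign coming from
    N.N = -1. *)
Lemma gauss_dot (R : realType) n (X : 'rV[R]_n -> 'rV[R]_n.+1) u
    (N Y Z : 'rV[R]_n.+1) (c : 'rV[R]_n) :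
  differentiable X u ->
  (forall x, x != 0 -> 0 < inner (induced X) u x x) ->
  (forall i, mdot N (frame X i u) = 0) -> mdot N N = -1 ->
  (forall l, \sum_k c 0 k * induced X u k l = mdot Y (frame X l u)) ->
  mdot Y Z = \sum_l c 0 l * mdot (frame X l u) Z - mdot Y N * mdot N Z.
Proof.
move=> dX pos NX NN cY.
have pos' x : x != 0 -> 0 < mdot (x *m 'J X u) (x *m 'J X u).
  by move=> /pos; rewrite inner_mdot.
have NJ i : mdot N (row i ('J X u)) = 0 by rewrite row_jacobian.
have NN0 : mdot N N < 0 by rewrite NN ltrN10.
have [x [d E]] := normal_spans pos' NJ NN0 Y.
have NJx y : mdot N (y *m 'J X u) = 0.
  rewrite mul_jacobian// mdot_sumr big1// => i _.
  by rewrite mdotZr NX mulr0.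
have dE : mdot Y N = - d.
  by rewrite E mdotDl mdotC NJx mdotZl NN add0r mulrN1.
have xE : x = c.
  have gu := induced_unitmx pos.
  have e : x *m induced X u = c *m induced X u.
    apply/rowP => l; rewrite !mxE cY {1}E mdotDl mdotZl NX mulr0 addr0.
    rewrite mul_jacobian// mdot_suml; apply: eq_bigr => i _.
    by rewrite mdotZl inducedE.
  by rewrite -[x](mulmxK gu) e mulmxK.
rewrite {1}E mdotDl mdotZl dE xE mulNr opprK; congr (_ + _).
rewrite mul_jacobian// mdot_suml; apply: eq_bigr => i _.
by rewrite mdotZl.
Qed.

(** For vectors known only to be orthogonal to the tangent space, such as the
    conormal of a hyperplane containing a piece of the hypersurface. *)
Lemma normal_line (R : realType) n (X : 'rV[R]_n -> 'rV[R]_n.+1) u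
    (N Y : 'rV[R]_n.+1) :
  differentiable X u ->
  (forall x, x != 0 -> 0 < inner (induced X) u x x) ->
  (forall i, mdot N (frame X i u) = 0) -> mdot N N = -1 ->
  (forall i, mdot Y (frame X i u) = 0) ->
  Y = - mdot Y N *: N.
Proof.
move=> dX pos NX NN YX.
apply/eqP; rewrite -subr_eq0; apply/eqP; apply: mdot_nondeg => Z.
rewrite mdotBl mdotZl.
rewrite (@gauss_dot _ _ X u N Y Z 0)//; last first.
  by move=> l; rewrite YX big1// => k _; rewrite mxE mul0r.
rewrite big1 => [|k _]; last by rewrite mxE mul0r.
by ring.
Qed.

Lemma tangent_sub (R : realType) n (X : 'rV[R]_n -> 'rV[R]_n.+1) u
    (N Y : 'rV[R]_n.+1) :
  differentiable X u ->
  (forall x, x != 0 -> 0 < inner (induced X) u x x) ->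
  (forall i, mdot N (frame X i u) = 0) -> mdot N N = -1 ->
  mdot Y N = 0 -> exists x, Y = x *m 'J X u.
Proof.
move=> dX pos NX NN YN.
have [x E] : exists c d, Y = c *m 'J X u + d *: N.
  apply: normal_spans; last by rewrite NN ltrN10.
    by move=> x /pos; rewrite inner_mdot.
  by move=> i; rewrite row_jacobian.
case: E => d E; exists x.
have : mdot Y N = - d.
  rewrite E mdotDl mul_jacobian// mdot_suml big1 => [|i _].
    by rewrite mdotZl NN add0r mulrN1.
  by rewrite mdotZl mdotC NX mulr0.
by rewrite YN => /eqP; rewrite eq_sym oppr_eq0 => /eqP d0; rewrite E d0 scale0r addr0.
Qed.

Section Gauss.
Variables (R : realType) (n : nat) (U : set 'rV[R]_n).
Variable (X : 'rV[R]_n -> 'rV[R]_n.+1).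
Hypotheses (oU : open U) (SX : smooth U X).
Hypothesis pos : forall u, U u -> forall x, x != 0 -> 0 < inner (induced X) u x x.
Variables (u : 'rV[R]_n) (N : 'rV[R]_n.+1).
Hypotheses (Uu : U u) (NX : forall i, mdot N (frame X i u) = 0) (NN : mdot N N = -1).

Let G := christoffel (induced X).
Let e i v := frame X i v.
Let ee i j v := frame (frame X j) i v.
Let eee i j k v := frame (frame (frame X k) j) i v.
Let g := induced X.
Let h i j := mdot (ee i j u) N.

Let dX : differentiable X u := smooth_differentiable SX Uu.
Let gU v (Uv : U v) : g v \in unitmx := induced_unitmx (pos Uv).

(** Differentiate Gamma^l_jk g_lm = X_jk.X_m along the i-th coordinate and
    replace X_jk in X_jk.X_im by the Gauss formula.  Only scalar functions are
    differentiated, so the normal is needed at the single point u. *)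
Lemma partial_christoffel i j k m :
  \sum_l partial i (G l j k) u * g u l m + \sum_l G l j k u * mdot (ee i l u) (e m u) =
  mdot (eee i j k u) (e m u) - h j k * h i m.
Proof.
have E q v : U v -> \sum_l G l j k v * g v l q = mdot (ee j k v) (e q v).
  by move=> Uv; apply: christoffel_induced SX Uv (gU Uv).
have /= := partial_eq_open i oU Uu (E m).
rewrite partial_sum_mul; last 2 first.
- move=> l; apply: smooth_differentiable Uu.
  by apply: smooth_christoffel => // v Uv; exact: gU.
- by move=> l; apply: smooth_differentiable Uu; exact: smooth_induced.
rewrite partial_mdot; last 2 first.
- by apply: smooth_differentiable Uu; do 2 apply: smooth_frame.
- by apply: smooth_differentiable Uu; exact: smooth_frame.
under [X in _ + X = _ -> _]eq_bigr do rewrite (partial_induced _ _ _ oU SX Uu) mulrDr.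
rewrite big_split/= addrA.
have -> : mdot (ee j k u) (frame (e m) i u) =
    \sum_l G l j k u * mdot (e l u) (ee i m u) - h j k * h i m.
  rewrite -[h i m]mdotC.
  have c l : \sum_q (\row_q G q j k u) 0 q * g u q l = mdot (ee j k u) (e l u).
    by rewrite -(E l u Uu); apply: eq_bigr => q _; rewrite mxE.
  rewrite (gauss_dot (ee i m u) dX (pos Uu) NX NN c); congr (_ - _).
  by apply: eq_bigr => l _; rewrite mxE.
have cancelC (A B C D H : R) : A + B + C = D + (C - H) -> A + B = D - H.
  by move=> eq; apply: (addIr C); rewrite eq; ring.
exact: cancelC.
Qed.

(** Antisymmetrize the preceding identity in i and j: the third derivatives
    of X cancel, since the ambient space is flat. *)
Lemma curv_lowered i j k m :
  \sum_l curv (induced X) i j k l u * g u l m = h i k * h j m - h j k * h i m.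
Proof.
have P a b c : \sum_l partial a (G l b c) u * g u l m =
    mdot (eee a b c u) (e m u) - h b c * h a m
    - \sum_l G l b c u * mdot (ee a l u) (e m u).
  by rewrite -partial_christoffel addrK.
have Q a b c : \sum_l (\sum_q G q b c u * G l a q u) * g u l m =
    \sum_l G l b c u * mdot (ee a l u) (e m u).
  under eq_bigr do rewrite mulr_suml.
  rewrite exchange_big/=; apply: eq_bigr => q _.
  rewrite -(christoffel_induced a q m oU SX Uu (gU Uu)) mulr_sumr.
  by apply: eq_bigr => l _; rewrite mulrA.
have -> : \sum_l curv (induced X) i j k l u * g u l m =
    \sum_l partial i (G l j k) u * g u l m - \sum_l partial j (G l i k) u * g u l m
    + (\sum_l (\sum_q G q j k u * G l i q u) * g u l m
       - \sum_l (\sum_q G q i k u * G l j q u) * g u l m).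
  rewrite -!sumrB -big_split/=; apply: eq_bigr => l _.
  by rewrite /curv sumrB mulrDl !mulrBl.
have S : mdot (eee i j k u) (e m u) = mdot (eee j i k u) (e m u).
  by congr mdot; exact: frame_comm (smooth_frame k SX) Uu.
have collect (s1 s2 q1 q2 e1 e2 h1 h2 t1 t2 : R) :
    s1 = e1 - h1 - t1 -> s2 = e2 - h2 - t2 -> q1 = t1 -> q2 = t2 -> e1 = e2 ->
    s1 - s2 + (q1 - q2) = h2 - h1.
  by move=> -> -> -> -> ->; ring.
exact: (collect _ _ _ _ _ _ _ _ _ _ (P i j k) (P j i k) (Q i j k) (Q j i k) S).
Qed.

(** The Gauss equation for a space-like hypersurface; for a time-like normal
    the sign is opposite to the Euclidean one. *)
Lemma riemann_gauss x y z w :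
  let hh a b := \sum_i \sum_j a 0 i * b 0 j * h i j in
  riemann (induced X) u x y z w = hh x z * hh y w - hh y z * hh x w.
Proof.
move=> hh; rewrite /riemann.
have -> : hh x z * hh y w = \sum_i \sum_j \sum_k \sum_m
    x 0 i * y 0 j * z 0 k * w 0 m * (h i k * h j m).
  rewrite /hh mulr_suml; apply: eq_bigr => i _.
  rewrite mulr_sumr; apply: eq_bigr => j _.
  rewrite mulr_suml; apply: eq_bigr => k _.
  by rewrite mulr_sumr; apply: eq_bigr => m _; rewrite mulrACA; congr (_ * _); ring.
have -> : hh y z * hh x w = \sum_i \sum_j \sum_k \sum_m
    x 0 i * y 0 j * z 0 k * w 0 m * (h j k * h i m).
  rewrite mulrC /hh mulr_suml; apply: eq_bigr => i _.
  rewrite mulr_sumr; apply: eq_bigr => j _.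
  rewrite mulr_sumr; apply: eq_bigr => k _.
  rewrite mulr_suml; apply: eq_bigr => m _.
  by rewrite mulrACA [h i m * _]mulrC; congr (_ * _); ring.
rewrite -sumrB; apply: eq_bigr => i _.
rewrite -sumrB; apply: eq_bigr => j _.
rewrite -sumrB; apply: eq_bigr => k _.
rewrite exchange_big -sumrB/=; apply: eq_bigr => m _.
rewrite -mulrBr -curv_lowered mulr_sumr; apply: eq_bigr => l _.
by rewrite mulrA.
Qed.

End Gauss.

(** * Covariant derivative of a tangent field *)

Section Nabla.
Variables (R : realType) (n : nat) (U : set 'rV[R]_n).
Variable (X : 'rV[R]_n -> 'rV[R]_n.+1).
Hypotheses (oU : open U) (SX : smooth U X).
Hypothesis pos : forall u, U u -> forall x, x != 0 -> 0 < inner (induced X) u x x.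
Variables (Y : 'rV[R]_n -> 'rV[R]_n.+1) (c : 'rV[R]_n -> 'rV[R]_n).
Hypotheses (SY : smooth U Y) (Yc : forall v, U v -> Y v = c v *m 'J X v).

Let G := christoffel (induced X).
Let g := induced X.
Let gU v (Uv : U v) : g v \in unitmx := induced_unitmx (pos Uv).

Lemma tangent_dot v l : U v ->
  \sum_k c v 0 k * g v k l = mdot (Y v) (frame X l v).
Proof.
move=> Uv; have dX := smooth_differentiable SX Uv.
rewrite Yc// mul_jacobian// mdot_suml; apply: eq_bigr => k _.
by rewrite mdotZl -inducedE.
Qed.

(** The components are obtained from the products Y.X_l by the inverse Gram
    matrix, and both are smooth. *)
Lemma smooth_tangent_components k : smooth U (fun v => c v 0 k : R^o).
Proof.
apply: (@smooth_ext _ _ _ _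
  (fun v => \sum_l mdot (Y v) (frame X l v) * invmx (g v) l k : R^o)) => //.
  move=> v Uv; have := congr1 (fun M : 'rV[R]_n => M 0 k) (mulmxK (gU Uv) (c v)).
  rewrite mxE => <-; apply: eq_bigr => l _.
  by rewrite mxE tangent_dot.
move=> q; apply: Ck_sum => // l _; apply: CkM => //.
  by apply: smooth_mdot => //; exact: smooth_frame.
by apply: Ck_invmx => // a b; exact: smooth_induced.
Qed.

Variables (u : 'rV[R]_n) (Uu : U u).

(** The covariant derivative is the tangential part of the ambient one:
    differentiate c^k g_kl = Y.X_l; the terms with X_il cancel against the
    derivatives of the metric. *)
Lemma nabla_dot x l :
  \sum_k nabla (induced X) u x c 0 k * g u k l =
  mdot (\sum_i x 0 i *: frame Y i u) (frame X l u).
Proof.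
have dX := smooth_differentiable SX Uu.
have D i : \sum_k partial i (fun v => c v 0 k) u * g u k l +
    \sum_k c u 0 k * mdot (frame (frame X k) i u) (frame X l u) =
    mdot (frame Y i u) (frame X l u).
  have /= := partial_eq_open i oU Uu (fun v => @tangent_dot v l).
  rewrite partial_sum_mul; last 2 first.
  - by move=> k; apply: smooth_differentiable Uu; exact: smooth_tangent_components.
  - by move=> k; apply: smooth_differentiable Uu; exact: smooth_induced.
  rewrite partial_mdot; last 2 first.
  - exact: smooth_differentiable Uu.
  - by apply: smooth_differentiable Uu; exact: smooth_frame.
  under [X in _ + X = _ -> _]eq_bigr do rewrite (partial_induced _ _ _ oU SX Uu) mulrDr.
  rewrite big_split/= addrA.
  have -> : mdot (Y u) (frame (frame X l) i u) =
      \sum_k c u 0 k * mdot (frame X k u) (frame (frame X l) i u).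
    rewrite Yc// mul_jacobian// mdot_suml; apply: eq_bigr => k _.
    by rewrite mdotZl.
  by move/addIr.
rewrite mdot_suml; under eq_bigr => k _ do rewrite mxE mulr_suml.
rewrite exchange_big/=; apply: eq_bigr => i _.
rewrite mdotZl -D mulrDr !mulr_sumr -big_split/=.
under [LHS]eq_bigr do rewrite -mulrA mulrDl mulrDr.
rewrite !big_split/=; congr (_ + _); rewrite -!mulr_sumr; congr (_ * _).
under eq_bigr do rewrite mulr_suml.
rewrite exchange_big/=; apply: eq_bigr => j _.
rewrite -(christoffel_induced i j l oU SX Uu (gU Uu)) mulr_sumr.
by apply: eq_bigr => k _; rewrite mulrAC mulrC.
Qed.

Lemma nabla_unique (x y : 'rV[R]_n) :
  (forall l, mdot (\sum_i x 0 i *: frame Y i u) (frame X l u) =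
             mdot (y *m 'J X u) (frame X l u)) ->
  nabla (induced X) u x c = y.
Proof.
move=> H; have dX := smooth_differentiable SX Uu.
suff e : nabla (induced X) u x c *m g u = y *m g u.
  by rewrite -[LHS](mulmxK (gU Uu)) e mulmxK//; exact: gU.
apply/rowP => l; rewrite !mxE nabla_dot H mul_jacobian// mdot_suml.
by apply: eq_bigr => i _; rewrite mdotZl inducedE.
Qed.

End Nabla.

(** * Points of charts and of submanifolds *)

(** The image of U is relatively open in M, in particular contained in it. *)
Lemma chart_mem (R : realType) (m N : nat) (M : set 'rV[R]_N) (U : set 'rV[R]_m)
    (X : 'rV[R]_m -> 'rV[R]_N) u : local_param M U X -> U u -> M (X u).
Proof.
move=> lp Uu; have [V [_ E]] := lp_openmap lp (lp_open lp) (@subset_refl _ U).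
have : (X @` U) (X u) by exists u.
by rewrite E => -[].
Qed.

Lemma ball_not_singleton (R : realType) m (y : 'rV[R]_m) (r : R) :
  (0 < m)%N -> 0 < r -> exists2 y', ball y r y' & y' != y.
Proof.
move=> m0 r0; pose e : 'rV[R]_m := const_mx 1.
have e0 : e != 0.
  by apply/eqP => /rowP /(_ (Ordinal m0)); rewrite !mxE => /eqP; rewrite oner_eq0.
(* t |e| < r *)
pose t := r / (`|e| + 1) / 2.
have p0 : 0 < `|e| + 1 by rewrite ltr_wpDl.
have t0 : 0 < t by rewrite !divr_gt0.
exists (y + t *: e).
  rewrite -ball_normE /= opprD addNKr normrN normrZ gtr0_norm//.
  rewrite /t mulrAC ltr_pdivrMr// mulrAC ltr_pdivrMr//.
  rewrite -mulrA ltr_pM2l//; have := normr_ge0 e; lra.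
by rewrite -subr_eq0 addrC addKr scaler_eq0 (negbTE e0) gt_eqF.
Qed.

Lemma submanifold_two_points (R : realType) (m q : nat) (A : set 'rV[R]_q) :
  (0 < m)%N -> submanifold m A -> A !=set0 -> exists a b, [/\ A a, A b & a != b].
Proof.
move=> m0 sA [a Aa]; have [V [Y [lpY [y Vy _]]]] := sA _ Aa.
have nV : nbhs y V by apply: open_nbhs_nbhs; split => //; exact: lp_open lpY.
have [r /= r0 Hr] := (nbhs_ballP _ _).1 nV.
have [y' By y'y] := ball_not_singleton y m0 r0; have Vy' := Hr _ By.
exists (Y y'), (Y y); split; [exact: chart_mem lpY Vy'|exact: chart_mem lpY Vy|].
apply: contraNneq y'y => /(lp_inj lpY); rewrite !inE => /(_ Vy' Vy) ->.
exact: eqxx.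
Qed.

(** * The geometry of a canal hypersurface *)

Section Canal.
Variables (R : realType) (n : nat) (M : set 'rV[R]_n.+1) (J : set R).
Variables (S : R -> set 'rV[R]_n.+1) (sigma : 'rV[R]_n.+1 -> R).
Variables (z : R -> 'rV[R]_n.+1) (rad : R -> R).
Hypothesis hM : canal_spacelike_hypersurface M J S sigma z rad.

Let N := canal_normal sigma z rad.

Lemma canal_fiber p : M p -> J (sigma p) /\ S (sigma p) p.
Proof.
move=> Mp; have := Mp; rewrite (canal_cover hM) => -[s Js Sp].
by have -> := (canal_param hM Mp Js).1 Sp.
Qed.

Lemma canal_rad_neq0 p : M p -> rad (sigma p) != 0.
Proof. by move=> /canal_fiber[Js _]; rewrite gt_eqF// (canal_radius_gt0 hM). Qed.

Lemma canal_position p : M p -> p - z (sigma p) = - rad (sigma p) *: N p.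
Proof.
move=> Mp; rewrite /N /canal_normal scalerN scaleNr opprK scalerA.
by rewrite divff ?scale1r// canal_rad_neq0.
Qed.

Lemma canal_normal_unit p : M p -> mdot (N p) (N p) = -1.
Proof.
move=> Mp; have [Js Sp] := canal_fiber Mp; have r0 := canal_rad_neq0 Mp.
have := canal_radius hM Js Sp.
rewrite canal_position// mdotZl mdotZr mulrA mulrNN -expr2 => e.
by apply: (mulfI (expf_neq0 2 r0)); rewrite e mulrN1.
Qed.

Section Chart.
Variables (U : set 'rV[R]_n) (X : 'rV[R]_n -> 'rV[R]_n.+1).
Hypothesis lp : local_param M U X.

Let s := sigma \o X.

Lemma chart_sigma_smooth : smooth U (s : _ -> R^o).
Proof. exact: canal_param_smooth hM _ _ lp. Qed.

Lemma chart_sigma u : U u -> J (s u).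
Proof. by move=> Uu; have [] := canal_fiber (chart_mem lp Uu). Qed.

Lemma chart_differentiable u : U u -> differentiable X u.
Proof. exact: (smooth_differentiable (lp_smooth lp)). Qed.

Lemma chart_pos u : U u -> forall x, x != 0 -> 0 < inner (induced X) u x x.
Proof. exact: (canal_spacelike hM).2 _ _ lp u. Qed.

Lemma center_normal u i : U u -> mdot (X u - z (s u)) (frame X i u) = 0.
Proof.
move=> Uu; have [Js Sp] := canal_fiber (chart_mem lp Uu).
have := canal_normals hM Js Sp lp Uu erefl (delta_mx 0 i).
by rewrite -rowE row_jacobian//; exact: chart_differentiable.
Qed.

Lemma canal_normal_frame u i : U u -> mdot (N (X u)) (frame X i u) = 0.
Proof.
by move=> Uu; rewrite /N /canal_normal mdotNl mdotZl center_normal// mulr0 oppr0.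
Qed.

Lemma center_curve_smooth : smooth U (z \o s).
Proof.
exact: (smooth_curve (lp_open lp) chart_sigma (canal_center_smooth hM) chart_sigma_smooth).
Qed.

Lemma center_curve1_smooth : smooth U (derive1 z \o s).
Proof.
apply: (smooth_curve (lp_open lp) chart_sigma _ chart_sigma_smooth).
exact: (smooth_derive1 (canal_open hM) (canal_center_smooth hM)).
Qed.

Lemma radius_curve_smooth : smooth U (rad \o s : _ -> R^o).
Proof.
exact: (smooth_curve (lp_open lp) chart_sigma (canal_radius_smooth hM) chart_sigma_smooth).
Qed.

Lemma radius_curve1_smooth : smooth U (derive1 rad \o s : _ -> R^o).
Proof.
apply: (smooth_curve (lp_open lp) chart_sigma _ chart_sigma_smooth).
exact: (smooth_derive1 (canal_open hM) (canal_radius_smooth hM)).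
Qed.

Lemma frame_from_center u i : U u ->
  frame (fun v => X v - z (s v)) i u = frame X i u - partial i s u *: derive1 z (s u).
Proof.
move=> Uu; rewrite -(frame_curve i (canal_center_smooth hM) chart_sigma_smooth (chart_sigma Uu) Uu).
rewrite frame.unlock; apply: deriveB; apply: diff_derivable.
  exact: chart_differentiable.
exact: (smooth_differentiable center_curve_smooth Uu).
Qed.

Lemma from_center_smooth : smooth U (fun v => X v - z (s v)).
Proof. exact: (smoothB (lp_open lp) (lp_smooth lp) center_curve_smooth). Qed.

(** Its vanishing is the relation (X - z(s)).z'(s) = R R'. *)
Let defect u := mdot (X u - z (s u)) (derive1 z (s u)) - rad (s u) * derive1 rad (s u).

Lemma defect_smooth : smooth U (defect : _ -> R^o).
Proof.
apply: (smoothB (lp_open lp) _ _).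
  exact: (smooth_mdot (lp_open lp) from_center_smooth center_curve1_smooth).
exact: (smooth_scale (lp_open lp) radius_curve_smooth radius_curve1_smooth).
Qed.

(** Differentiate (X - z(s))^2 = - R(s)^2, where (X - z(s)).X_i = 0. *)
Lemma defect_partial u i : U u -> partial i s u * defect u = 0.
Proof.
move=> Uu; have oU := lp_open lp.
have E v : U v -> mdot (X v - z (s v)) (X v - z (s v)) = - (rad (s v) * rad (s v)).
  move=> Uv; have [Js Sp] := canal_fiber (chart_mem lp Uv).
  by rewrite (canal_radius hM Js Sp) expr2.
have dY : differentiable (fun v => X v - z (s v)) u.
  exact: (smooth_differentiable from_center_smooth Uu).
have dr : differentiable (rad \o s : _ -> R^o) u.
  exact: (smooth_differentiable radius_curve_smooth Uu).
have := partial_eq_open i oU Uu E.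
rewrite (partial_mdot i dY dY) frame_from_center//.
have -> : partial i (fun v => - (rad (s v) * rad (s v))) u =
    - (2 * (rad (s u) * (partial i s u * derive1 rad (s u)))).
  rewrite (partialN i (differentiable_scale dr dr)) (partialM i dr dr).
  rewrite (partial_curve i (canal_radius_smooth hM) chart_sigma_smooth (chart_sigma Uu) Uu).
  by rewrite /comp; ring.
rewrite (mdotC (frame X i u - _)) mdotBr mdotZr center_normal//.
rewrite /defect => e.
have : 2 * (partial i s u * defect u) = 0 by rewrite /defect; move: e; lra.
by move/eqP; rewrite mulf_eq0 pnatr_eq0 /= => /eqP.
Qed.

(** A non-zero vector v orthogonal to the tangent space at y is a multiple of N,
    hence of X y - z; the multiple is determined by v.(X y) = d and by R. *)
Lemma flat_chart_point y v d (Uy : U y) : v != 0 -> mdot v (X y) = d ->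
  (forall i, mdot v (frame X i y) = 0) ->
  X y = z (s y) - (rad (s y) ^+ 2 / (d - mdot v (z (s y)))) *: v.
Proof.
move=> v0 vX vF; have My := chart_mem lp Uy.
have NN := canal_normal_unit My; have r0 : rad (s y) != 0 := canal_rad_neq0 My.
have E := normal_line (chart_differentiable Uy) (chart_pos Uy)
  (fun i => canal_normal_frame i Uy) NN vF.
have P : X y - z (s y) = - rad (s y) *: N (X y) := canal_position My.
set q := - mdot v (N (X y)) in E.
have q0 : q != 0 by apply: contraNneq v0 => q0; rewrite E q0 scale0r.
have -> : d - mdot v (z (s y)) = rad (s y) * q.
  rewrite -vX -mdotBr P mdotZr E mdotZl NN; ring.
apply/eqP; rewrite addrC -subr_eq; apply/eqP; rewrite P E scalerA -scaleNr.
by congr (_ *: _); field; rewrite r0 q0.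
Qed.

Hypothesis n_gt0 : (0 < n)%N.

(** Where the defect does not vanish, s is locally constant by
    [defect_partial], so a ball of the chart is mapped into one generator, and in
    particular into a hyperplane; [flat_chart_point] then gives the same image for
    two points of the ball, against injectivity. *)
Lemma canal_center_eq u : U u -> defect u = 0.
Proof.
move=> Uu; apply/eqP; apply: contraT => f0.
have cf := smooth_differentiable defect_smooth Uu.
have {cf}cf := differentiable_continuous cf.
have nf : nbhs u [set y | defect y != 0].
  exact: cf _ (open_nbhs_nbhs (conj (@open_neq R 0) f0)).
have nU : nbhs u U by apply: open_nbhs_nbhs; split => //; exact: lp_open lp.
have [r /= r0 Hr] := (nbhs_ballP _ _).1 (filterI nU nf).
have sc y : ball u r y -> s y = s u.
  apply: (derive_zero_const r0) => {}y /Hr[Uy fy].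
  have ds := smooth_differentiable chart_sigma_smooth Uy.
  split=> // v; apply: derive_partials => // i.
  by have /eqP := defect_partial i Uy; rewrite mulf_eq0 (negbTE fy) orbF => /eqP.
have [Js _] := canal_fiber (chart_mem lp Uu).
(* v and d give the hyperplane that contains the generator through X u *)
have [c [rr [v [d [_ v0 SE _ _]]]]] := canal_sphere hM Js.
have vX y : ball u r y -> mdot v (X y) = d.
  move=> By; have [Uy _] := Hr _ By.
  have [_] := canal_fiber (chart_mem lp Uy); rewrite -/(s y) [sigma (X y)](sc _ By).
  by rewrite SE => -[].
have vF y i : ball u r y -> mdot v (frame X i y) = 0.
  move=> By; have [Uy _] := Hr _ By.
  have oB : open (ball u r) by exact: ball_open.
  have := partial_eq_open i oB By vX.
  rewrite (partial_mdot (Y := cst v))//; last exact: chart_differentiable.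
  rewrite frame.unlock derive_cst mdot0l add0r /cst => ->.
  by rewrite /partial derive_cst.
have Bu : ball u r u by exact: ballxx.
have [y By yu] := ball_not_singleton u n_gt0 r0.
have [Uy _] := Hr _ By.
have E1 := flat_chart_point Uu v0 (vX _ Bu) (fun i => vF u i Bu).
have E2 := flat_chart_point Uy v0 (vX _ By) (fun i => vF y i By).
have : X y = X u by rewrite E2 E1 sc.
by move/(lp_inj lp); rewrite !inE => /(_ Uy Uu) e; rewrite e eqxx in yu.
Qed.

Let w u := derive1 z (s u) - derive1 rad (s u) *: N (X u).

Lemma center_velocity_normal u : U u ->
  mdot (derive1 z (s u)) (N (X u)) = - derive1 rad (s u).
Proof.
move=> Uu; have My := chart_mem lp Uu.
have r0 : rad (s u) != 0 := canal_rad_neq0 My.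
have P : X u - z (s u) = - rad (s u) *: N (X u) := canal_position My.
have := canal_center_eq Uu; rewrite /defect P mdotZl mdotC => /eqP.
rewrite mulNr -opprD oppr_eq0 -mulrDr mulf_eq0 (negbTE r0) addr_eq0.
by move/eqP.
Qed.

Lemma canal_w_normal u : U u -> mdot (w u) (N (X u)) = 0.
Proof.
move=> Uu; rewrite mdotBl mdotZl center_velocity_normal//.
by rewrite (canal_normal_unit (chart_mem lp Uu)); ring.
Qed.

Lemma canal_w_sq u : U u ->
  mdot (w u) (w u) = mdot (derive1 z (s u)) (derive1 z (s u)) + derive1 rad (s u) ^+ 2.
Proof.
move=> Uu; rewrite [X in mdot _ X = _]/w mdotBr mdotZr canal_w_normal// mulr0 subr0.
by rewrite mdotBl mdotZl (mdotC (N _)) center_velocity_normal//; ring.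
Qed.

Lemma canal_w_tangent u : U u -> exists x, w u = x *m 'J X u.
Proof.
move=> Uu; apply: (@tangent_sub _ _ X u (N (X u))).
- exact: chart_differentiable.
- exact: chart_pos.
- by move=> i; exact: canal_normal_frame.
- exact: canal_normal_unit (chart_mem lp Uu).
- exact: canal_w_normal.
Qed.

(** A tangent vector with non-positive square vanishes because M is
    space-like. *)
Lemma canal_w_eq0 u : U u ->
  mdot (derive1 z (s u)) (derive1 z (s u)) + derive1 rad (s u) ^+ 2 <= 0 ->
  derive1 z (s u) = derive1 rad (s u) *: N (X u).
Proof.
move=> Uu; rewrite -canal_w_sq// leNgt => H; apply/eqP; rewrite -subr_eq0.
apply: contraNT H => w0; have [x E] := canal_w_tangent Uu.
rewrite E -inner_mdot; apply: chart_pos => //.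
by apply: contraNneq w0 => x0; rewrite -/(w u) E x0 mul0mx.
Qed.

End Chart.

(** * The unit field of a canal hypersurface *)

Hypothesis hell : elliptic_type J z.
Hypothesis n_gt1 : (1 < n)%N.
Let n_gt0 : (0 < n)%N := ltnW n_gt1.

(** The square of the tangential vector t - R' N, a function of the
    parameter alone by [canal_w_sq]. *)
Definition canal_sqnorm (t : R) : R :=
  mdot (derive1 z t) (derive1 z t) + derive1 rad t ^+ 2.

Lemma canal_generator_mem t p : J t -> S t p -> M p /\ sigma p = t.
Proof.
move=> Jt Sp; have Mp : M p by rewrite (canal_cover hM); exists t.
by split=> //; apply/(canal_param hM Mp Jt).
Qed.

(** Otherwise z'(t) = R'(t) N on the generator, where R'(t) != 0 because
    z'(t) is time-like; then N is constant on the generator, which would be a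
    point. *)
Lemma canal_sqnorm_gt0 t : J t -> 0 < canal_sqnorm t.
Proof.
move=> Jt; rewrite ltNge; apply/negP => H.
have [c [r [v [d [_ _ _ S0 sS]]]]] := canal_sphere hM Jt.
have m0 : (0 < n.-1)%N by rewrite -subn1 subn_gt0.
have [a [b [Sa Sb /eqP ab]]] := submanifold_two_points m0 sS S0.
have dN p : S t p -> derive1 z t = derive1 rad t *: N p.
  move=> Sp; have [Mp st] := canal_generator_mem Jt Sp.
  have [V [Y [lpY [y Vy Yp]]]] := (canal_spacelike hM).1 _ Mp.
  have := canal_w_eq0 lpY n_gt0 Vy; rewrite /= Yp st; exact.
have r0 : derive1 rad t != 0.
  apply: contraTneq (hell Jt) => r0.
  by rewrite (dN _ Sa) r0 scale0r mdot0l ltxx.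
have : N a = N b by apply: (scalerI r0); rewrite -!dN.
move=> eN; apply: ab.
have [Ma sa] := canal_generator_mem Jt Sa; have [Mb sb] := canal_generator_mem Jt Sb.
by rewrite -(subrK (z t) a) -{1}sa canal_position// sa eN -{1}sb -canal_position// sb subrK.
Qed.

Let mu t := (Num.sqrt (canal_sqnorm t))^-1.

Definition canal_k_curve t : R := mu t * derive1 rad t / rad t.

(** Along the hypersurface, xi(p) = canal_xi_offset s + canal_k_curve s *: p
    with s = sigma p. *)
Definition canal_xi_offset t : 'rV[R]_n.+1 :=
  mu t *: derive1 z t - canal_k_curve t *: z t.

(** Written A in the comments: the factor of proportionality between the
    tangential part of z' and the gradient of sigma; see [center_velocity_frame]. *)
Definition canal_slope p : R :=
  mdot (derive1 z (sigma p)) (derive1 z (sigma p))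
  - mdot (p - z (sigma p)) (derive1 (derive1 z) (sigma p))
  + derive1 rad (sigma p) ^+ 2 + rad (sigma p) * derive1 (derive1 rad) (sigma p).

Definition canal_a p : R := - (rad (sigma p) ^+ 2)^-1.
Definition canal_b p : R := canal_sqnorm (sigma p) / (canal_slope p * rad (sigma p) ^+ 2).
Definition canal_k p : R := canal_k_curve (sigma p).

Lemma smooth_canal_sqnorm : smooth (J : set R^o) (canal_sqnorm : R^o -> R^o).
Proof.
have oJ := canal_open hM.
apply: (smoothD oJ).
  by apply: (smooth_mdot (V := R^o)) => //;
     exact: (smooth_derive1 oJ (canal_center_smooth hM)).
by apply: (smooth_scale oJ); exact: (smooth_derive1 oJ (canal_radius_smooth hM)).
Qed.

Lemma mu_neq0 t : J t -> mu t != 0.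
Proof. by move=> Jt; rewrite invr_eq0 gt_eqF// sqrtr_gt0 canal_sqnorm_gt0. Qed.

Lemma mu_sq t : J t -> mu t ^+ 2 = (canal_sqnorm t)^-1.
Proof. by move=> Jt; rewrite exprVn sqr_sqrtr// ltW// canal_sqnorm_gt0. Qed.

Lemma smooth_mu : smooth (J : set R^o) (mu : R^o -> R^o).
Proof.
have oJ := canal_open hM; move=> k; apply: (CkV oJ _ _).
  by move=> t Jt; rewrite gt_eqF// sqrtr_gt0 canal_sqnorm_gt0.
apply: (Ck_sqrt oJ _ (smooth_canal_sqnorm k)) => t; exact: canal_sqnorm_gt0.
Qed.

Lemma smooth_canal_k_curve : smooth (J : set R^o) (canal_k_curve : R^o -> R^o).
Proof.
have oJ := canal_open hM.
apply: (smooth_scale oJ); last first.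
  move=> k; apply: (CkV oJ _ (canal_radius_smooth hM k)) => t Jt.
  by rewrite gt_eqF// (canal_radius_gt0 hM).
apply: (smooth_scale oJ smooth_mu _).
exact: (smooth_derive1 oJ (canal_radius_smooth hM)).
Qed.

Lemma smooth_canal_xi_offset : smooth (J : set R^o) (canal_xi_offset : R^o -> 'rV[R]_n.+1).
Proof.
have oJ := canal_open hM.
apply: (smoothB oJ).
  exact: (smooth_scale oJ smooth_mu (smooth_derive1 oJ (canal_center_smooth hM))).
exact: (smooth_scale oJ smooth_canal_k_curve (canal_center_smooth hM)).
Qed.

Section UnitField.
Variables (U : set 'rV[R]_n) (X : 'rV[R]_n -> 'rV[R]_n.+1).
Hypothesis lp : local_param M U X.
Let s := sigma \o X.
Let xi := canal_xi sigma z rad.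
Let w u := derive1 z (s u) - derive1 rad (s u) *: N (X u).

Lemma canal_xiE u : U u -> xi (X u) = mu (s u) *: w u.
Proof.
move=> Uu; rewrite /xi /canal_xi -/N -[sigma (X u)]/(s u) -/(w u).
by rewrite (canal_w_sq lp n_gt0 Uu).
Qed.

Lemma canal_xi_curve u : U u ->
  xi (X u) = canal_xi_offset (s u) + canal_k_curve (s u) *: X u.
Proof.
move=> Uu; rewrite canal_xiE// /canal_xi_offset -addrA (addrC (- _)) -scalerBr.
rewrite (canal_position (chart_mem lp Uu)) /w scalerBr; congr (_ + _).
rewrite !scalerA -scaleNr; congr (_ *: _).
by rewrite /canal_k_curve mulrN divfK ?(canal_rad_neq0 (chart_mem lp Uu)).
Qed.

Lemma canal_xi_smooth : smooth U (xi \o X).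
Proof.
have oU := lp_open lp; have Js := chart_sigma lp; have Ss := chart_sigma_smooth lp.
apply: (smooth_ext (f := fun u => canal_xi_offset (s u) + canal_k_curve (s u) *: X u)) => //.
  by move=> u Uu; rewrite -canal_xi_curve.
apply: (smoothD oU (smooth_curve oU Js smooth_canal_xi_offset Ss) _).
exact: (smooth_scale oU (smooth_curve oU Js smooth_canal_k_curve Ss) (lp_smooth lp)).
Qed.

Lemma canal_xi_unit u : U u -> mdot (xi (X u)) (xi (X u)) = 1.
Proof.
move=> Uu; have Js := chart_sigma lp Uu.
rewrite canal_xiE// mdotZl mdotZr (canal_w_sq lp n_gt0 Uu) mulrA -expr2 mu_sq//.
by rewrite mulVf// gt_eqF// canal_sqnorm_gt0.
Qed.

Lemma canal_xi_tangent u : U u -> (xi (X u) <= 'J X u)%MS.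
Proof.
move=> Uu; have [x E] := canal_w_tangent lp n_gt0 Uu.
by rewrite canal_xiE// /w E scalemx_sub// submxMl.
Qed.

Lemma canal_components u : U u -> components X xi u *m 'J X u = xi (X u).
Proof. by move=> Uu; rewrite /components mulmxKpV// canal_xi_tangent. Qed.

(** Differentiate (X - z(s)).z'(s) = R(s) R'(s). *)
Lemma center_velocity_frame u i : U u ->
  mdot (derive1 z (s u)) (frame X i u) = canal_slope (X u) * partial i s u.
Proof.
move=> Uu; have oU := lp_open lp; have Js := chart_sigma lp Uu.
have Sz := canal_center_smooth hM; have Sr := canal_radius_smooth hM.
have oJ := canal_open hM.
have E v : U v -> mdot (X v - z (s v)) (derive1 z (s v)) = rad (s v) * derive1 rad (s v).
  by move=> Uv; have /eqP := canal_center_eq lp n_gt0 Uv; rewrite subr_eq0 => /eqP.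
have := partial_eq_open i oU Uu E.
rewrite (partial_mdot (Y := fun v => X v - z (s v))); last 2 first.
- exact: (smooth_differentiable (from_center_smooth lp) Uu).
- exact: (smooth_differentiable (center_curve1_smooth lp) Uu).
rewrite (partialM (a := rad \o s) (b := derive1 rad \o s)); last 2 first.
- exact: (smooth_differentiable (radius_curve_smooth lp) Uu).
- exact: (smooth_differentiable (radius_curve1_smooth lp) Uu).
rewrite (frame_from_center lp)//.
rewrite (frame_curve i (smooth_derive1 oJ Sz) (chart_sigma_smooth lp) Js Uu).
rewrite (partial_curve i Sr (chart_sigma_smooth lp) Js Uu).
rewrite (partial_curve i (smooth_derive1 oJ Sr) (chart_sigma_smooth lp) Js Uu).
rewrite (mdotBl (frame X i u)) mdotZl mdotZr (mdotC (frame X i u)).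
have collect (F p ZZ XZ r r1 r2 : R) :
    F - p * ZZ + p * XZ = p * r1 * r1 + r * (p * r2) ->
    F = (ZZ - XZ + r1 ^+ 2 + r * r2) * p.
  move=> e; have -> : F = (F - p * ZZ + p * XZ) + p * ZZ - p * XZ by ring.
  by rewrite e; ring.
exact: collect.
Qed.

Lemma canal_w_frame u i : U u -> mdot (w u) (frame X i u) = canal_slope (X u) * partial i s u.
Proof.
move=> Uu; rewrite mdotBl mdotZl (canal_normal_frame lp)// mulr0 subr0.
exact: center_velocity_frame.
Qed.

(** The vector w = t - R' N is tangent and non-zero, while its products with the
    X_i are multiples of canal_slope. *)
Lemma canal_slope_neq0 u : U u -> canal_slope (X u) != 0.
Proof.
move=> Uu; have := canal_sqnorm_gt0 (chart_sigma lp Uu).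
have [x E] := canal_w_tangent lp n_gt0 Uu.
rewrite /canal_sqnorm -(canal_w_sq lp n_gt0 Uu) [X in mdot _ X]E.
rewrite (mul_jacobian _ (chart_differentiable lp Uu)) mdot_sumr.
apply: contraTneq => A0; rewrite big1 ?ltxx// => i _.
by rewrite mdotZr canal_w_frame// A0 mul0r mulr0.
Qed.

(** * Second fundamental form and curvature *)

(** Differentiate (X - z(s)).X_j = 0 and use X - z(s) = - R N. *)
Lemma canal_second_form u i j : U u ->
  mdot (frame (frame X j) i u) (N (X u)) =
  (rad (s u))^-1 *
    (induced X u i j - canal_slope (X u) * (partial i s u * partial j s u)).
Proof.
move=> Uu; have oU := lp_open lp; have My := chart_mem lp Uu.
have r0 : rad (s u) != 0 := canal_rad_neq0 My.
have dX := chart_differentiable lp Uu.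
have P : X u - z (s u) = - rad (s u) *: N (X u) := canal_position My.
have E v : U v -> mdot (X v - z (s v)) (frame X j v) = 0.
  exact: center_normal.
have := partial_eq_open i oU Uu E.
rewrite (partial_mdot (Y := fun v => X v - z (s v))); last 2 first.
- exact: (smooth_differentiable (from_center_smooth lp) Uu).
- exact: (smooth_differentiable (smooth_frame j (lp_smooth lp)) Uu).
rewrite (frame_from_center lp)// partial_cst P.
rewrite (mdotBl (frame X i u)) mdotZl mdotZl (center_velocity_frame j Uu).
rewrite -(inducedE i j dX) (mdotC (N _)).
have solve_h (g p h r q A : R) : r != 0 -> g - p * (A * q) + - r * h = 0 ->
    h = r^-1 * (g - A * (p * q)).
  move=> rn e; apply: (mulfI rn); rewrite mulVKf//.
  have -> : r * h = g - p * (A * q) - (g - p * (A * q) + - r * h) by ring.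
  by rewrite e; ring.
exact: solve_h.
Qed.

Lemma canal_eta u x : U u ->
  inner (induced X) u (components X xi u) x =
  mu (s u) * canal_slope (X u) * \sum_i x 0 i * partial i s u.
Proof.
move=> Uu; rewrite inner_mdot canal_components// canal_xiE// mdotZl -mulrA.
congr (_ * _); rewrite (mul_jacobian _ (chart_differentiable lp Uu)).
rewrite mdot_sumr mulr_sumr; apply: eq_bigr => i _.
by rewrite mdotZr canal_w_frame// mulrCA.
Qed.

(** The gradient of sigma is proportional to xi, so the second fundamental form
    is g - (w.w / A) eta (x) eta up to the factor 1 / R. *)
Lemma canal_second_form_sum u (x y : 'rV[R]_n) : U u ->
  \sum_i \sum_j x 0 i * y 0 j * mdot (frame (frame X j) i u) (N (X u)) =
  (rad (s u))^-1 * (inner (induced X) u x y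
    - canal_sqnorm (s u) / canal_slope (X u)
      * (inner (induced X) u (components X xi u) x
         * inner (induced X) u (components X xi u) y)).
Proof.
move=> Uu; have Js := chart_sigma lp Uu.
have A0 := canal_slope_neq0 Uu; have m0 := mu_neq0 Js.
have rho0 : canal_sqnorm (s u) != 0 by rewrite gt_eqF// canal_sqnorm_gt0.
rewrite !canal_eta//.
set sx := \sum_i x 0 i * _; set sy := \sum_i y 0 i * _.
(* eta(x) = mu A ds(x), where mu^2 is the inverse of w.w *)
have -> : canal_sqnorm (s u) / canal_slope (X u) *
    (mu (s u) * canal_slope (X u) * sx * (mu (s u) * canal_slope (X u) * sy)) =
    canal_slope (X u) * (sx * sy).
  transitivity (canal_sqnorm (s u) * (mu (s u) ^+ 2) * (canal_slope (X u) * (sx * sy))).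
    by field.
  by rewrite mu_sq// divff// mul1r.
rewrite innerE /sx /sy mulr_suml mulr_sumr -sumrB mulr_sumr.
apply: eq_bigr => i _; rewrite mulr_sumr mulr_sumr -sumrB mulr_sumr.
by apply: eq_bigr => j _; rewrite canal_second_form//; ring.
Qed.

(** Insert the second fundamental form into the Gauss equation; the terms of
    fourth order in eta cancel. *)
Lemma canal_curvature u x y v t : U u ->
  riemann (induced X) u x y v t =
    canal_a (X u) * pi_form (induced X) u x y v t
    + canal_b (X u) * phi_form (induced X) (components X xi) u x y v t.
Proof.
move=> Uu; have My := chart_mem lp Uu.
have r0 : rad (s u) != 0 := canal_rad_neq0 My.
rewrite (riemann_gauss (lp_open lp) (lp_smooth lp) (chart_pos lp) Uu
  (fun i => canal_normal_frame lp i Uu) (canal_normal_unit My)).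
rewrite !canal_second_form_sum// /canal_a /canal_b -[sigma (X u)]/(s u).
rewrite /pi_form /phi_form.
move: r0 (canal_slope_neq0 Uu); move: (rad (s u)) (canal_slope (X u)) (canal_sqnorm (s u)).
move: (inner (induced X) u x v) (inner (induced X) u y t).
move: (inner (induced X) u y v) (inner (induced X) u x t).
move: (inner _ u _ x) (inner _ u _ y) (inner _ u _ v) (inner _ u _ t).
by move=> ex ey ev et gyv gxt gyt gxv r A rho r0 A0; field; rewrite r0 A0.
Qed.

(** In the ambient derivative of xi = P(s) + q(s) X, the terms with
    ds vanish on vectors orthogonal to xi, and q(s) dX remains. *)
Lemma canal_nabla u x : U u ->
  inner (induced X) u (components X xi u) x = 0 ->
  nabla (induced X) u x (components X xi) = canal_k (X u) *: x.
Proof.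
move=> Uu eta0; have oU := lp_open lp; have Js := chart_sigma lp.
have Ss := chart_sigma_smooth lp; have dX := chart_differentiable lp Uu.
(* eta(x) = mu A ds(x) with mu and A non-zero *)
have ds0 : \sum_i x 0 i * partial i s u = 0.
  move/eqP: eta0; rewrite canal_eta// mulf_eq0 mulf_eq0.
  by rewrite (negbTE (mu_neq0 (Js _ Uu))) (negbTE (canal_slope_neq0 Uu)) /= => /eqP.
apply: (nabla_unique oU (lp_smooth lp) (chart_pos lp) canal_xi_smooth _ Uu).
  by move=> y Uy; rewrite canal_components.
move=> l; congr mdot.
have SP : smooth U (canal_xi_offset \o s) := smooth_curve oU Js smooth_canal_xi_offset Ss.
have Sk : smooth U (canal_k_curve \o s : _ -> R^o) :=
  smooth_curve oU Js smooth_canal_k_curve Ss.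
(* the vector multiplying d_i s is the same for all i, so ds(x) = 0 kills that summand *)
have F i : frame (xi \o X) i u = partial i s u *:
    (derive1 canal_xi_offset (s u) + derive1 canal_k_curve (s u) *: X u)
    + canal_k_curve (s u) *: frame X i u.
  have E y : U y -> (xi \o X) y = (canal_xi_offset \o s) y + canal_k_curve (s y) *: X y.
    exact: canal_xi_curve.
  have -> : frame (xi \o X) i u =
      frame (fun y => (canal_xi_offset \o s) y + canal_k_curve (s y) *: X y) i u.
    by rewrite frame.unlock; exact: near_eq_derive_open E.
  have dP := smooth_differentiable SP Uu; have dk := smooth_differentiable Sk Uu.
  have -> : frame (fun y => (canal_xi_offset \o s) y + canal_k_curve (s y) *: X y) i u =
      frame (canal_xi_offset \o s) i u +
      (partial i (canal_k_curve \o s) u *: X u + canal_k_curve (s u) *: frame X i u).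
    rewrite frame.unlock; apply: etrans (deriveD _ _) _.
    - exact: diff_derivable.
    - by apply: diff_derivable; exact: (differentiable_scale dk dX).
    by congr (_ + _); exact: (derive_scale _ dk dX).
  rewrite (frame_curve i smooth_canal_xi_offset Ss (Js _ Uu) Uu).
  rewrite (partial_curve i smooth_canal_k_curve Ss (Js _ Uu) Uu).
  by rewrite addrA scalerDr scalerA.
under eq_bigr do rewrite F scalerDr !scalerA.
rewrite big_split/= -scaler_suml ds0 scale0r add0r.
rewrite (mul_jacobian _ dX); apply: eq_bigr => i _.
by rewrite mxE mulrC.
Qed.

Lemma canal_sectional u x y : U u -> orthonormal (induced X) u x y ->
  sectional (induced X) u x y = canal_a (X u) + canal_b (X u) *
    (inner (induced X) u (components X xi u) x ^+ 2 +
     inner (induced X) u (components X xi u) y ^+ 2).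
Proof.
move=> Uu [xx yy xy]; rewrite /sectional canal_curvature//.
have yx : inner (induced X) u y x = 0 by rewrite inner_mdot mdotC -inner_mdot.
by rewrite /pi_form /phi_form xx yy xy yx; ring.
Qed.

(** The residual of xi after projection on the plane is a tangent vector, so
    its square is non-negative. *)
Lemma canal_bessel u x y : U u -> orthonormal (induced X) u x y ->
  inner (induced X) u (components X xi u) x ^+ 2 +
  inner (induced X) u (components X xi u) y ^+ 2 <= 1.
Proof.
move=> Uu [xx yy xy]; set c := components X xi u.
have cc : inner (induced X) u c c = 1 by rewrite inner_mdot canal_components// canal_xi_unit.
rewrite -subr_ge0 opprD addrA.
set ex := inner _ _ _ x; set ey := inner _ _ _ y.
have <- : inner (induced X) u (c - ex *: x - ey *: y) (c - ex *: x - ey *: y) =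
    1 - ex ^+ 2 - ey ^+ 2.
  move: xx yy xy cc; rewrite /ex /ey !inner_mdot !mulmxBl -!scalemxAl.
  exact: mdot_residual.
have [->|v0] := eqVneq (c - ex *: x - ey *: y) 0.
  by rewrite inner_mdot mul0mx mdot0l.
exact: ltW (chart_pos lp Uu v0).
Qed.

(** By Bessel's inequality the cosine lies in the domain on which arccosine is
    injective, so equal angles give equal values of eta(x)^2 + eta(y)^2. *)
Lemma canal_quasi_constant u : U u ->
  quasi_constant_at (induced X) (components X xi) u.
Proof.
move=> Uu x y x' y' o o'; rewrite /plane_angle !canal_sectional//.
set c := _ ^+ 2 + _; set c' := inner _ _ _ x' ^+ 2 + _.
have c0 : 0 <= c by rewrite addr_ge0// sqr_ge0.
have c0' : 0 <= c' by rewrite addr_ge0// sqr_ge0.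
have c1 : c <= 1 by exact: canal_bessel.
have c1' : c' <= 1 by exact: canal_bessel.
have I (q : R) : 0 <= q -> q <= 1 -> -1 <= Num.sqrt q <= 1.
  move=> q0 q1; apply/andP; split.
    by rewrite (le_trans _ (sqrtr_ge0 q))// lerN10.
  by rewrite -[leRHS]sqrtr1 ler_wsqrtr.
move=> /(congr1 cos); rewrite !acosK ?in_itv/= ?I// => e.
by rewrite -[c]sqr_sqrtr// e sqr_sqrtr.
Qed.

End UnitField.

Lemma canal_a_lt0 p : M p -> canal_a p < 0.
Proof.
move=> Mp; rewrite oppr_lt0 invr_gt0 exprn_gt0//.
by have [Js _] := canal_fiber Mp; exact: canal_radius_gt0 hM _ Js.
Qed.

(** The sum equals - z'.z' / (w.w R^2). *)
Lemma canal_a_k_gt0 p : M p -> 0 < canal_a p + canal_k p ^+ 2.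
Proof.
move=> Mp; have [Js _] := canal_fiber Mp; have r0 := canal_rad_neq0 Mp.
have sp := canal_sqnorm_gt0 Js.
have -> : canal_a p + canal_k p ^+ 2 =
    - mdot (derive1 z (sigma p)) (derive1 z (sigma p)) /
      (canal_sqnorm (sigma p) * rad (sigma p) ^+ 2).
  rewrite /canal_k /canal_k_curve !exprMn mu_sq// exprVn /canal_a.
  have s0 : canal_sqnorm (sigma p) != 0 by rewrite gt_eqF.
  have -> : - mdot (derive1 z (sigma p)) (derive1 z (sigma p)) =
            derive1 rad (sigma p) ^+ 2 - canal_sqnorm (sigma p).
    by rewrite /canal_sqnorm; ring.
  move: s0 r0; move: (canal_sqnorm _) (rad _) (derive1 rad _) => q r d q0 r0.
  by field; rewrite q0 r0.
rewrite divr_gt0// ?oppr_gt0; first exact: hell.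
by rewrite mulr_gt0// exprn_even_gt0//= r0.
Qed.

End Canal.

Theorem proposition3p6 (R : realType) (n : nat) (hn : (4 <= n)%N)
    (M : set 'rV[R]_n.+1) (J : set R) (S : R -> set 'rV[R]_n.+1)
    (sigma : 'rV[R]_n.+1 -> R) (z : R -> 'rV[R]_n.+1) (rad : R -> R)
    (hM : canal_spacelike_hypersurface M J S sigma z rad)
    (hell : elliptic_type J z) :
  QC_manifold M (canal_xi sigma z rad) /\
  exists a b k : 'rV[R]_n.+1 -> R,
    [/\ QC_curvature M (canal_xi sigma z rad) a b,
        QC_k M (canal_xi sigma z rad) k &
        forall p, M p -> a p < 0 /\ 0 < a p + k p ^+ 2].
Proof.
have n1 : (1 < n)%N by exact: leq_trans hn.
split.
  split; first exact: (canal_spacelike hM).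
    move=> U X lp; split; first exact: (canal_xi_smooth hM hell n1 lp).
    move=> u Uu; split; first exact: (canal_xi_tangent hM n1 lp Uu).
    exact: (canal_xi_unit hM hell n1 lp Uu).
  move=> U X lp u Uu; exact: (canal_quasi_constant hM hell n1 lp Uu).
exists (canal_a sigma rad), (canal_b sigma z rad), (canal_k sigma z rad); split.
- by move=> U X lp u Uu x y v t; exact: (canal_curvature hM hell n1 lp).
- by move=> U X lp u Uu x; exact: (canal_nabla hM hell n1 lp).
- by move=> p Mp; split; [exact: (canal_a_lt0 hM)|exact: (canal_a_k_gt0 hM hell n1)].
Qed.
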